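(* Let $\alpha>\frac65$ and let $\Sigma$, $\Phi(t)$ be the full-measure set and the global flow described in the context. Let $\sigma<\frac{\alpha-1}2$. Then for $\mu$ almost every $u_0\in\Sigma$ and all $t\in\mathbb R$, there is a subsequence $(n_k)_{k\in\mathbb N}$, $n_k\to\infty$, of $(1,2,3,\dots)$ such that the solution $u(t)=\Phi(t)u_0$ of $$i\partial_tu+|D_x|^\alpha u+|u|^2u=0,\qquad u|_{t=0}=u_0$$ satisfies $$\lim_{k\to\infty}\|u(n_kt)-u_0\|_{H^\sigma(\mathbb T)}=0.$$
   Context: $\mathbb T=\mathbb R/2\pi\mathbb Z$; $|D_x|^\alpha$ is the Fourier multiplier by $|n|^\alpha$. $\mu$ is the law of $\sum_{n\in\mathbb Z}\frac{g_n}{(1+|n|^\alpha)^{1/2}}e^{inx}$ with $(g_n)$ independent standard complex Gaussians ($\mathbb E|g_n|^2=1$), and $d\rho=e^{-V}d\mu$ with $V(u)=\frac12\cdot\frac1{2\pi}\int_0^{2\pi}|u|^4dx$. For $\alpha>\frac65$ there is a measurable set $\Sigma$ of full $\rho$ measure (equivalently full $\mu$ measure) such that for each $\phi\in\Sigma$ the Cauchy problem $i\partial_tu+|D_x|^\alpha u+|u|^2u=0$, $u|_{t=0}=\phi$, has a global solution $u(t)=\Phi(t)\phi$ with $u(t)-e^{\frac{it}\pi\int_0^{2\pi}|\phi|^2dx}e^{it|D_x|^\alpha}\phi\in C(\mathbb R;H^s(\mathbb T))$ for some $s\in(\frac12-\frac\alpha4,\alpha-1)$, unique in the class where $e^{-\frac{it}\pi\int_0^{2\pi}|\phi|^2dx}u-e^{it|D_x|^\alpha}\phi\in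 X^{s,b}_T$ for all $T>0$ (some $b>\frac12$); here $X_T^{s,b}$ is the restriction to $[-T,T]$ of the Bourgain space with norm $\|\langle n\rangle^s\langle\tau-|n|^\alpha\rangle^b\widehat u(\tau,n)\|_{L^2_\tau\ell^2_n}$. The flow satisfies $\Phi(t)(\Sigma)=\Sigma$, $\Phi(t_1)\circ\Phi(t_2)=\Phi(t_1+t_2)$ and $\rho(\Phi(t)A)=\rho(A)$ for all $\rho$-measurable $A\subset\Sigma$ and all $t$. $\Sigma$ is equipped with the topology inherited from the separable space $H^\sigma(\mathbb T)$. *)

(* Defs.v *)
From HB Require Import structures.
From mathcomp Require Import all_boot all_order all_algebra.
From mathcomp Require Import complex.
From mathcomp Require Import all_classical all_reals all_analysis.

Set Implicit Arguments.
Unset Strict Implicit.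
Unset Printing Implicit Defensive.

Import Order.TTheory GRing.Theory Num.Theory.
Import numFieldNormedType.Exports.

Local Open Scope classical_set_scope.
Local Open Scope ring_scope.
Local Open Scope complex_scope.

Notation normc := ComplexField.Normc.normc.
Notation cRe := (@complex.Re _).
Notation cIm := (@complex.Im _).

(* A distribution u on the torus R/2piZ is represented by the sequence of its
   Fourier coefficients (u n), n in Z. The sigma-algebra is the one generated
   by the coefficients; its trace on each H^s is the Borel sigma-algebra of
   H^s. *)
Definition coef_cylinders (R : realType) : set (set (int -> R[i])) :=
  [set E | exists n : int, exists2 B : set (R * R), measurable B &
     E = [set u | B (cRe (u n), cIm (u n))]].

HB.instance Definition _ (R : realType) := isPointed.Build R[i] 0.

Notation torus_dist R := (g_sigma_algebraType (@coef_cylinders R)).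

Section fourier.
Context {R : realType}.
Implicit Types (u v : int -> R[i]) (f : R -> R[i]) (x s t alpha : R) (n : int).

Notation leb := (@lebesgue_measure R).

Definition cis x : R[i] := cos x +i* sin x.

Definition cRintegral (D : set R) f : R[i] :=
  (\int[leb]_(x in D) cRe (f x)) +i* (\int[leb]_(x in D) cIm (f x)).

Definition cmeasurable (D : set R) f : Prop :=
  measurable_fun D (cRe \o f) /\ measurable_fun D (cIm \o f).

Definition period : set R := `[0, 2 * pi].

Definition bracket x : R := Num.sqrt (1 + x ^+ 2).

(* |n|^alpha *)
Definition symbol alpha n : R := (`|n|%:~R) `^ alpha.

Definition sobolev_norm s u : \bar R :=
  ((\esum_(n in [set: int])
      ((bracket n%:~R) `^ (2 * s) * normc (u n) ^+ 2)%:E) `^ 2^-1)%E.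

Definition in_sobolev s u : Prop := (sobolev_norm s u < +oo)%E.

Definition continuous_in_sobolev s (w : R -> int -> R[i]) : Prop :=
  (forall t, in_sobolev s (w t)) /\
  (forall t, sobolev_norm s (fun n => w t' n - w t n) @[t' --> t] --> 0%E).

Definition partial_sum u (N : nat) x : R[i] :=
  \sum_(k < (2 * N).+1)
     u (k%:Z - N%:Z) * cis ((k%:Z - N%:Z)%:~R * x).

Definition L2_sum u f : Prop :=
  cmeasurable period f /\
  (\int[leb]_(x in period) (normc (f x - partial_sum u N x) ^+ 2)%:E)%E
    @[N --> \oo] --> 0%E.

(* The function sum_n u_n e^{inx}, unique up to a.e. equality on a period when
   u is in L^2 (i.e. square summable); only used for such u. *)
Definition realization u : R -> R[i] := xget (fun=> 0) [set f | L2_sum u f].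

Definition fourier_coef f n : R[i] :=
  ((2 * pi)^-1)%:C * cRintegral period (fun x => f x * cis (- (n%:~R * x))).

(* int_0^{2pi} |u|^2 dx *)
Definition mass u : R := \int[leb]_(x in period) (normc (realization u x) ^+ 2).

Definition potential u : \bar R :=
  ((2^-1 * (2 * pi)^-1)%:E *
   \int[leb]_(x in period) (normc (realization u x) ^+ 4)%:E)%E.

(* n-th Fourier coefficient of |u|^2 u *)
Definition cubic u n : R[i] :=
  fourier_coef
    (fun x => (normc (realization u x) ^+ 2)%:C * realization u x) n.

(* e^{it|D_x|^alpha} u *)
Definition free_flow alpha t u : int -> R[i] :=
  fun n => cis (t * symbol alpha n) * u n.

Definition gauge u t : R[i] := cis (t / pi * mass u).

Definition oriented_integral (h : R -> R[i]) t : R[i] :=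
  if 0 <= t then cRintegral `[0, t] h else - cRintegral `[t, 0] h.

(* w belongs to X^{s,b}_T, for b > 1/2: on [-T, T] it coincides with the
   inverse time Fourier transform of some F with finite weighted norm. As
   b > 1/2, each F n is integrable, so the inversion integral converges
   absolutely. *)
Definition in_bourgain alpha s b (T : R) (w : R -> int -> R[i]) : Prop :=
  exists F : int -> R -> R[i],
    [/\ forall n, cmeasurable setT (F n),
        (\esum_(n in [set: int]) \int[leb]_tau
           ((bracket n%:~R) `^ (2 * s) *
            (bracket (tau - symbol alpha n)) `^ (2 * b) *
            normc (F n tau) ^+ 2)%:E < +oo)%E &
        forall t n, `|t| <= T ->
          w t n = cRintegral setT (fun tau => F n tau * cis (t * tau))].

(* Solution in C(R; H^sigma) of i u_t + |D_x|^alpha u + |u|^2 u = 0 with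
   u(0) = phi. The equation is meant in the sense of distributions: it is
   integrated in time and tested against each e^{inx}. The L^2 and L^3_loc
   conditions give a meaning to |u|^2 u as a locally integrable function. *)
Record solves alpha sigma (phi : int -> R[i]) (u : R -> int -> R[i]) : Prop := {
  solves_init : u 0 = phi ;
  solves_cont : continuous_in_sobolev sigma u ;
  solves_L2 : forall t, in_sobolev 0 (u t) ;
  solves_L3loc : forall T : R, (\int[leb]_(t in `[(- T)%R, T%R])
     \int[leb]_(x in period) (normc (realization (u t) x) ^+ 3)%:E < +oo)%E ;
  solves_eq : forall t n,
     'i%C * (u t n - phi n) +
     oriented_integral
       (fun r => (symbol alpha n)%:C * u r n + cubic (u r) n) t = 0 }.

(* u(t) - e^{(it/pi) int |phi|^2} e^{it|D_x|^alpha} phi *)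
Definition duhamel_part alpha phi (u : R -> int -> R[i]) : R -> int -> R[i] :=
  fun t n => u t n - gauge phi t * free_flow alpha t phi n.

(* e^{-(it/pi) int |phi|^2} u(t) - e^{it|D_x|^alpha} phi *)
Definition gauged_duhamel_part alpha phi (u : R -> int -> R[i]) :
    R -> int -> R[i] :=
  fun t n => gauge phi (- t) * u t n - free_flow alpha t phi n.

Definition in_uniqueness_class alpha s b phi (u : R -> int -> R[i]) : Prop :=
  forall T : R, 0 < T -> in_bourgain alpha s b T (gauged_duhamel_part alpha phi u).

End fourier.

Section gaussian_measure.
Context {R : realType} d {Omega : measurableType d}.
Variable P : probability Omega R.

Definition ReIm (z : R[i]) : R * R := (cRe z, cIm z).

(* E|g|^2 = 1: real and imaginary parts are independent and N(0, 1/2); the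
   second argument of normal_prob is the standard deviation. *)
Definition standard_complex_gaussian (g : Omega -> R[i]) : Prop :=
  measurable_fun setT (ReIm \o g) /\
  forall B : set (R * R), measurable B ->
    P ((ReIm \o g) @^-1` B) =
    (normal_prob 0 (Num.sqrt 2^-1) \x normal_prob 0 (Num.sqrt 2^-1))%E B.

Definition mutually_independent (g : int -> Omega -> R[i]) : Prop :=
  forall (J : seq int) (B : int -> set (R * R)), uniq J ->
    (forall n, measurable (B n)) ->
    P (\bigcap_(n in [set` J]) ((ReIm \o g n) @^-1` B n)) =
    (\prod_(n <- J) P ((ReIm \o g n) @^-1` B n))%E.

(* sum_n g_n / (1 + |n|^alpha)^{1/2} e^{inx} *)
Definition random_series (alpha : R) (g : int -> Omega -> R[i])
    (omega : Omega) : torus_dist R :=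
  fun n => g n omega / (Num.sqrt (1 + symbol alpha n))%:C.

Definition is_law_of (X : Omega -> torus_dist R)
    (mu : set (torus_dist R) -> \bar R) : Prop :=
  measurable_fun setT X /\
  forall A : set (torus_dist R), measurable A -> mu A = pushforward P X A.

End gaussian_measure.

Section gibbs_flow.
Context {R : realType}.
Variables (alpha sigma : R).

Definition is_gibbs (mu rho : {measure set (torus_dist R) -> \bar R}) : Prop :=
  forall A : set (torus_dist R), measurable A ->
    rho A = (\int[mu]_(u in A) expeR (- potential u))%E.

(* "rho-measurable" means measurable for the completion of rho, given by the
   outer measure rho^*. The topology on Sigma being that of H^sigma, solutions
   are continuous in time with values in H^sigma. *)
Record gibbs_flow (rho : {measure set (torus_dist R) -> \bar R})
    (Sigma : set (torus_dist R)) (Phi : R -> torus_dist R -> torus_dist R) :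
    Prop := {
  flow_measurable : measurable Sigma ;
  flow_full : rho (~` Sigma) = 0%E ;
  flow_solution : forall phi, Sigma phi ->
    exists s b : R,
      [/\ 2^-1 - alpha / 4 < s < alpha - 1, 2^-1 < b,
          solves alpha sigma phi (Phi ^~ phi)
            /\ continuous_in_sobolev s (duhamel_part alpha phi (Phi ^~ phi)),
          in_uniqueness_class alpha s b phi (Phi ^~ phi) &
          forall v : R -> int -> R[i],
            solves alpha sigma phi v ->
            in_uniqueness_class alpha s b phi v ->
            v = Phi ^~ phi] ;
  flow_image : forall t, Phi t @` Sigma = Sigma ;
  flow_group : forall t1 t2 phi, Sigma phi ->
    Phi t1 (Phi t2 phi) = Phi (t1 + t2) phi ;
  flow_invariant : forall t (A : set (torus_dist R)), A `<=` Sigma ->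
    (rho^*)%mu.-caratheodory A ->
    (rho^*)%mu.-caratheodory (Phi t @` A) /\
    ((rho^*)%mu (Phi t @` A) = (rho^*)%mu A) }.

End gibbs_flow.

(* Main.v *)
(** The flow [Phi] carries the finite measure [rho] to itself, so Poincare's
    recurrence theorem applies; the difficulty is that the exceptional null set
    must not depend on [t].  For this, recurrence is applied not to points but
    to orbits, seen in the separable space of [H^sigma]-valued paths with
    locally uniform convergence: for almost every [x] and all [M] there are
    arbitrarily large integers [n], of either sign, for which [Phi (s + n) x]
    is close to [Phi s x] uniformly in [|s| <= M].  Choosing such integers one
    after the other, all the differences of their partial sums are return times
    of [x]; by the pigeonhole principle one of these differences is nearly a
    multiple of [t], which makes [x] recurrent under [Phi t].  No continuity of
    [Phi t] on phase space is used.

    A [rho]-null set is [mu]-null because the potential is finite [mu]-almost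
    everywhere: it is dominated by the lower limit of the fourth powers of the
    [L^4] norms of the partial sums, whose expectation is controlled by
    Fatou's lemma and a Khintchine-type inequality, which only needs that [mu]
    is invariant under the change of sign of one Fourier coefficient. *)

Require Import Defs.
From HB Require Import structures.
From mathcomp Require Import all_boot all_order all_algebra.
From mathcomp Require Import complex.
From mathcomp Require Import all_classical all_reals all_analysis.
From mathcomp Require Import measurable_realfun.
From mathcomp Require Import ring lra zify.

Set Implicit Arguments.
Unset Strict Implicit.
Unset Printing Implicit Defensive.

Import Order.TTheory GRing.Theory Num.Theory.
Import numFieldNormedType.Exports.

Local Open Scope classical_set_scope.
Local Open Scope ring_scope.

(** * The Sobolev energy *)

Section sobolev_energy.
Context {R : realType}.
Implicit Types (u v w : int -> R[i]%C) (s e : R).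

Lemma sqr_normc_ReIm (z : R[i]%C) : normc z ^+ 2 = cRe z ^+ 2 + cIm z ^+ 2.
Proof. by case: z => a b /=; rewrite sqr_sqrtr// addr_ge0// sqr_ge0. Qed.

Lemma pow4_normc_ReIm (z : R[i]%C) :
  normc z ^+ 4 = (cRe z ^+ 2 + cIm z ^+ 2) ^+ 2.
Proof. by rewrite -sqr_normc_ReIm -exprM. Qed.

Lemma sqr_normcD_le (z1 z2 : R[i]%C) :
  normc (z1 + z2) ^+ 2 <= 2 * (normc z1 ^+ 2 + normc z2 ^+ 2).
Proof.
rewrite !sqr_normc_ReIm; case: z1 z2 => [a b] [c d] /=.
by have := sqr_ge0 (a - c); have := sqr_ge0 (b - d); nra.
Qed.

Definition sobolev_weight s (n : int) : R := (bracket n%:~R) `^ (2 * s).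

(** The square of [sobolev_norm]. As a plain sum of nonnegative terms it is easier to split, compare
    and measure than its root, so closeness is expressed with it throughout and the norm returns
    only in the final limit. *)
Definition sobolev_energy s u : \bar R :=
  \esum_(n in [set: int]) (sobolev_weight s n * normc (u n) ^+ 2)%:E.

Lemma sobolev_term_ge0 s u n : 0 <= sobolev_weight s n * normc (u n) ^+ 2.
Proof. by rewrite mulr_ge0 ?powR_ge0// sqr_ge0. Qed.

Lemma sobolev_energy_ge0 s u : (0 <= sobolev_energy s u)%E.
Proof. by apply: esum_ge0 => n _; rewrite lee_fin sobolev_term_ge0. Qed.

Lemma sobolev_normE s u : sobolev_norm s u = (sobolev_energy s u `^ 2^-1)%E.
Proof. by []. Qed.

Lemma sobolev_energyE s u : sobolev_energy s u = (sobolev_norm s u `^ 2)%E.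
Proof.
by rewrite sobolev_normE -poweRrM mulVf// poweRe1// sobolev_energy_ge0.
Qed.

Lemma in_sobolevP s u : in_sobolev s u -> (sobolev_energy s u < +oo)%E.
Proof. by move=> su; rewrite sobolev_energyE poweR_lty. Qed.

Lemma sobolev_energy_le s u e : 0 <= e ->
  (sobolev_norm s u <= e%:E)%E -> (sobolev_energy s u <= (e ^+ 2)%:E)%E.
Proof.
move=> e0 ue; rewrite sobolev_energyE -powR_mulrn// -poweR_EFin.
by apply: gt0_ler_poweR; rewrite // in_itv/= leey ?poweR_ge0 ?lee_fin ?e0.
Qed.

Lemma sobolev_norm_le s u e : 0 <= e ->
  (sobolev_energy s u <= (e ^+ 2)%:E)%E -> (sobolev_norm s u <= e%:E)%E.
Proof.
move=> e0 ue; rewrite sobolev_normE.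
have -> : (e%:E = (e ^+ 2)%:E `^ 2^-1)%E.
  by rewrite poweR_EFin powR12_sqrt ?sqr_ge0// sqrtr_sqr ger0_norm.
apply: gt0_ler_poweR;
  by rewrite // in_itv/= leey ?sobolev_energy_ge0 ?lee_fin ?sqr_ge0.
Qed.

Lemma sobolev_energyD s u v :
  (sobolev_energy s (fun n => (u n + v n)%R) <=
   2%:E * (sobolev_energy s u + sobolev_energy s v))%E.
Proof.
rewrite /sobolev_energy -esumD; try by move=> n _; rewrite lee_fin sobolev_term_ge0.
rewrite [leRHS]mule_natl mule2n -esumD;
  try by move=> n _; rewrite -EFinD lee_fin addr_ge0// sobolev_term_ge0.
apply: le_esum => n _; rewrite -!EFinD lee_fin.
have := ler_wpM2l (powR_ge0 (bracket n%:~R) (2 * s)) (sqr_normcD_le (u n) (v n)).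
by rewrite -/(sobolev_weight s n); lra.
Qed.

(** A triangle inequality for the squared norm. The factor 2 comes from $|z_1+z_2|^2\le
    2(|z_1|^2+|z_2|^2)$ and explains the constants in later chains of approximations. *)
Lemma sobolev_energy_trans s u v w e1 e2 :
  (sobolev_energy s (fun n => (u n - v n)%R) <= e1%:E)%E ->
  (sobolev_energy s (fun n => (v n - w n)%R) <= e2%:E)%E ->
  (sobolev_energy s (fun n => (u n - w n)%R) <= (2 * (e1 + e2))%:E)%E.
Proof.
move=> uv vw; have := sobolev_energyD s (fun n => u n - v n) (fun n => v n - w n).
under [X in sobolev_energy _ X]eq_fun do rewrite subrKA.
move=> /le_trans; apply; rewrite EFinM lee_pmul2l// EFinD; exact: leeD.
Qed.

Lemma sobolev_energyC s u v :
  sobolev_energy s (fun n => (u n - v n)%R) =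
  sobolev_energy s (fun n => (v n - u n)%R).
Proof.
apply: eq_esum => n _; congr (_ * _)%:E.
by rewrite -normcN opprB.
Qed.

Lemma sobolev_energy_subrr s u : sobolev_energy s (fun n => (u n - u n)%R) = 0%E.
Proof.
by apply: esum1 => n _; rewrite subrr ComplexField.Normc.normc0 expr0n mulr0.
Qed.

Lemma sobolev_norm_cvg0P s (u : nat -> int -> R[i]%C) :
  (forall k, sobolev_energy s (u k) <= (k.+1%:R^-1)%:E)%E ->
  sobolev_norm s (u k) @[k --> \oo] --> 0%E.
Proof.
move=> uk; apply/fine_cvgP; split.
  apply: nearW => k; rewrite sobolev_normE fin_num_poweR// ge0_fin_numE.
    by rewrite (le_lt_trans (uk k))// ltry.
  exact: sobolev_energy_ge0.
apply/cvgrPdist_le => e e0; near=> k; rewrite sub0r normrN.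
have uke : (sobolev_norm s (u k) <= e%:E)%E.
  apply: sobolev_norm_le; first exact: ltW.
  rewrite (le_trans (uk k))// lee_fin -[leRHS]invrK lef_pV2 ?posrE ?ltr0n//.
    near: k; exists (Num.truncn ((e ^+ 2)^-1)) => // k /= ek.
    by rewrite (le_trans (ltW (Num.Theory.truncnS_gt _)))// ler_nat.
  by rewrite invr_gt0 exprn_gt0.
have u0 : (0 <= sobolev_norm s (u k))%E by rewrite sobolev_normE poweR_ge0.
rewrite ger0_norm ?fine_ge0// -lee_fin fineK// ge0_fin_numE//.
by rewrite (le_lt_trans uke)// ltry.
Unshelve. all: by end_near. Qed.

Lemma continuous_sobolev_energy s (w : R -> int -> R[i]%C) (t e : R) :
  continuous_in_sobolev s w -> 0 < e ->
  exists2 d : R, 0 < d & forall t', `|t' - t| <= d ->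
    (sobolev_energy s (fun n => (w t' n - w t n)%R) <= e%:E)%E.
Proof.
move=> [_ /(_ t) wt] e0.
have sq : 0 < Num.sqrt e by rewrite sqrtr_gt0.
have [d /= d0 dP] : \forall t' \near t,
    (sobolev_norm s (fun n => (w t' n - w t n)%R) < (Num.sqrt e)%:E)%E.
  apply: (wt [set y | (y < (Num.sqrt e)%:E)%E]).
  by apply: open_nbhs_nbhs; split; [exact: open_ereal_lt_ereal|rewrite /= lte_fin].
(* Halving turns the open neighbourhood of radius [d] into a closed condition on [t']. *)
exists (d / 2); first by rewrite divr_gt0.
move=> t' t'd; rewrite -(sqr_sqrtr (ltW e0)); apply: sobolev_energy_le => //.
apply/ltW/dP; rewrite /= distrC (le_lt_trans t'd)//.
by rewrite ltr_pdivrMr// ltr_pMr// ltr1n.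
Qed.

(** * Measurability of Sobolev balls and separability *)

Lemma measurable_coef (n : int) (B : set (R * R)) : measurable B ->
  measurable [set u : torus_dist R | B (cRe (u n), cIm (u n))].
Proof. by move=> mB; apply: sub_sigma_algebra; exists n; exists B. Qed.

Lemma measurable_coef_pair (n : int) :
  measurable_fun [set: torus_dist R]
    (fun u : torus_dist R => (cRe (u n), cIm (u n))).
Proof. by move=> _ B mB; rewrite setTI; exact: measurable_coef. Qed.

Lemma measurable_coef_Re (n : int) :
  measurable_fun [set: torus_dist R] (fun u : torus_dist R => cRe (u n)).
Proof. exact: (measurableT_comp measurable_fst (measurable_coef_pair n)). Qed.

Lemma measurable_coef_Im (n : int) :
  measurable_fun [set: torus_dist R] (fun u : torus_dist R => cIm (u n)).
Proof. exact: (measurableT_comp measurable_snd (measurable_coef_pair n)). Qed.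

Definition zball (N : nat) : set int := [set n | (`|n| <= N)%N].

Lemma finite_zball N : finite_set (zball N).
Proof.
apply: (@sub_finite_set _ _ ((fun k : nat => k%:Z - N%:Z) @` `I_(2 * N).+1)).
  by move=> n; rewrite /zball /= => nN; exists (absz (n + N%:Z)%R); rewrite /=; lia.
exact/finite_image/finite_II.
Qed.

Lemma finite_sub_zball (F : set int) : finite_set F -> exists N, F `<=` zball N.
Proof.
move=> /finite_seqP[r ->]; exists (\max_(i <- r) `|i|%N) => i /= ir.
by rewrite /zball /=; exact: (@leq_bigmax_seq _ r xpredT (fun i : int => `|i|%N)).
Qed.

(** The sets [zball N] exhaust the integers and every finite set lies in one of them. A bound on the
    energy thus becomes countably many conditions, each on finitely many coefficients, which makes
    closed balls measurable. *)
Lemma sobolev_energy_leP s u (e : \bar R) :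
  (sobolev_energy s u <= e)%E <-> (forall N : nat,
    (\sum_(n \in zball N) (sobolev_weight s n * normc (u n) ^+ 2)%:E <= e)%E).
Proof.
split=> [ue N|H].
  apply: le_trans ue; apply: esum_ge; exists (zball N) => //.
  by split=> //; exact: finite_zball.
apply: ge_ereal_sup => _ [F [finF _] <-]; have [N FN] := finite_sub_zball finF.
apply: le_trans (H N); apply: lee_fsum_nneg_subset => //.
- exact: finite_zball.
- exact/subsetP.
- by move=> n _; rewrite lee_fin sobolev_term_ge0.
Qed.

Lemma measurable_sobolev_ball s (v : int -> R[i]%C) (e : \bar R) :
  measurable [set u : torus_dist R |
    (sobolev_energy s (fun n => (u n - v n)%R) <= e)%E].
Proof.
rewrite (_ : [set _ | _] = \bigcap_N [set u : torus_dist R | (\sum_(n \in zball N)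
    (sobolev_weight s n * normc (u n - v n) ^+ 2)%:E <= e)%E]); last first.
  apply/seteqP; split => [u /sobolev_energy_leP H N _|u H]; first exact: H.
  by apply/sobolev_energy_leP => N; exact: H.
apply: bigcapT_measurable => N.
rewrite -[X in measurable X]setTI; apply: emeasurable_fun_infty_c => //.
apply: emeasurable_fsum; first exact: finite_zball.
move=> n; apply/measurable_EFinP; apply: measurable_funM => //.
rewrite (_ : (fun u : torus_dist R => _) = fun u : torus_dist R =>
  (cRe (u n) - cRe (v n)) ^+ 2 + (cIm (u n) - cIm (v n)) ^+ 2); last first.
  by apply/funext => u; rewrite sqr_normc_ReIm !raddfB.
apply: measurable_funD; apply: measurable_funX; apply: measurable_funB => //.
  exact: measurable_coef_Re.
exact: measurable_coef_Im.
Qed.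

Lemma sobolev_separable s : exists D : nat -> int -> R[i]%C,
  forall u (e : R), (sobolev_energy s u < +oo)%E -> 0 < e -> exists k,
    (sobolev_energy s (fun n => (u n - D k n)%R) <= e%:E)%E.
Proof.
(* The dense family consists of finitely supported sequences with rational real and imaginary parts,
   coded by lists. Integers that code no list give the zero sequence. *)
pose D' (c : seq (int * (rat * rat))) (n : int) : R[i]%C :=
  \sum_(p <- c | p.1 == n) (ratr p.2.1 +i* ratr p.2.2)%C.
exists (fun k => D' (odflt [::] (unpickle k))) => u e uoo e0.
suff [c cP] : exists c, (sobolev_energy s (fun n => (u n - D' c n)%R) <= e%:E)%E.
  by exists (pickle c); rewrite pickleK.
(* One half of [e] is for the tail outside a finite set [F], the other for the rational
   approximation on [F]. *)
have e20 : 0 < e / 2 by rewrite divr_gt0.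
have ufin : sobolev_energy s u \is a fin_num.
  by rewrite ge0_fin_numE// sobolev_energy_ge0.
have [_ [F [finF _] <-] Fe] := ub_ereal_sup_adherent e20 ufin.
pose a n := (sobolev_weight s n * normc (u n) ^+ 2)%:E.
have a0 n : (0 <= a n)%E by rewrite lee_fin sobolev_term_ge0.
have tail : (\esum_(n in ~` F) a n <= (e / 2)%:E)%E.
  have uF : sobolev_energy s u = (\esum_(n in F) a n + \esum_(n in ~` F) a n)%E.
    by rewrite /sobolev_energy (esumID F) => [|n _]; [rewrite !setTI|exact: a0].
  have aF : \esum_(n in F) a n = (\sum_(n \in F) a n)%E by exact: esum_fset.
  have {}Fe : (sobolev_energy s u - (e / 2)%:E < \sum_(n \in F) a n)%E by [].
  rewrite -aF uF in Fe.
  have Ffin : \esum_(n in F) a n \is a fin_num.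
    rewrite ge0_fin_numE ?esum_ge0//; apply: le_lt_trans uoo.
    by rewrite uF leeDl// esum_ge0.
  have tfin : \esum_(n in ~` F) a n \is a fin_num.
    rewrite ge0_fin_numE ?esum_ge0//; apply: le_lt_trans uoo.
    by rewrite uF leeDr// esum_ge0.
  move: Fe Ffin tfin; case: (esum F a) => // x; case: (esum (~` F) a) => // y.
  by rewrite -EFinD -EFinB lte_fin lee_fin => ? _ _; lra.
pose r := finmap.enum_fset (fset_set F).
(* The share of each mode of [F]; the successor keeps the denominator nonzero when [F] is empty. *)
pose del := e / 2 / (size r).+1%:R.
have del0 : 0 < del by rewrite divr_gt0.
have approx (x eta : R) : 0 < eta -> exists q : rat, (x - ratr q) ^+ 2 <= eta ^+ 2.
  move=> eta0; have [q] := @rat_in_itvoo R (x - eta) (x + eta) ltac:(lra).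
  by rewrite in_itv/= => /andP[? ?]; exists q; nra.
have /choice[q qP] : forall n : int, exists q : rat * rat,
    sobolev_weight s n * normc (u n - (ratr q.1 +i* ratr q.2)%C) ^+ 2 <= del.
  move=> n; pose w := sobolev_weight s n.
  have w0 : 0 <= w by exact: powR_ge0.
  (* With both parts within [eta], the weighted error is at most $2w\,\eta^2 = del\cdot w/(w+1)\le
     del$. *)
  pose eta := Num.sqrt (del / (2 * (w + 1))).
  have eta2 : eta ^+ 2 = del / (2 * (w + 1)).
    by rewrite sqr_sqrtr// divr_ge0 ?ltW// mulr_gt0// ltr_wpDl.
  have eta0 : 0 < eta.
    by rewrite sqrtr_gt0 divr_gt0// mulr_gt0// ltr_wpDl.
  have [q1 q1P] := approx (cRe (u n)) _ eta0.
  have [q2 q2P] := approx (cIm (u n)) _ eta0.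
  exists (q1, q2); rewrite -/w sqr_normc_ReIm !raddfB/=.
  apply: (@le_trans _ _ (w * (2 * eta ^+ 2))).
    by apply: ler_wpM2l => //; lra.
  rewrite eta2 (_ : w * _ = del * (w / (w + 1))); last first.
    by field; rewrite gt_eqF// ltr_wpDl.
  apply: ler_piMr; first exact: ltW.
  by rewrite ler_pdivrMr ?mul1r ?lerDl// ltr_wpDl.
pose c := [seq (n, q n) | n <- r].
have DE n : D' c n = if n \in r then (ratr (q n).1 +i* ratr (q n).2)%C else 0.
  rewrite /D' /c big_map /=; have ur : uniq r by exact: finmap.fset_uniq.
  case: ifPn => nr.
    by rewrite -big_filter filter_pred1_uniq// big_seq1.
  rewrite big1_seq// => m /andP[/eqP -> mr]; by rewrite mr in nr.
have rF n : (n \in r) = (n \in F) by rewrite /r; exact: in_fset_set.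
exists c; rewrite /sobolev_energy (esumID F); last first.
  by move=> n _; exact: (sobolev_term_ge0 s (fun n => u n - D' c n)).
rewrite !setTI (splitr e) EFinD; apply: leeD; last first.
  apply: le_trans tail; apply: le_esum => n nF.
  by rewrite DE rF memNset// subr0.
rewrite esum_fset//; last first.
  by move=> n _; exact: (sobolev_term_ge0 s (fun n => u n - D' c n)).
rewrite fsbig_finite//= -/r big_seq sumEFin lee_fin.
apply: (@le_trans _ _ (\sum_(i <- r) del)).
  rewrite [leRHS]big_seq; apply: ler_sum => n nr; rewrite DE nr; exact: qP.
rewrite big_const_seq count_predT iter_addr_0 -(mulr_natr del) /del.
rewrite -(mulrA (e / 2)). apply: ler_piMr; first exact: ltW.
by rewrite mulrC ler_pdivrMr// mul1r ler_nat.
Qed.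

End sobolev_energy.

(** * Poincare recurrence *)

Section poincare.
Context d (T : measurableType d) (R : realType).
Variable nu : {measure set T -> \bar R}.
Variables (S : set T) (f : T -> T).
Hypothesis mS : measurable S.
Hypothesis nuS : (nu S < +oo)%E.
Hypothesis f_inj : forall x y, S x -> S y -> f x = f y -> x = y.
Hypothesis fS : forall x, S x -> S (f x).
Hypothesis f_pres : forall A, A `<=` S -> measurable A ->
  measurable (f @` A) /\ nu (f @` A) = nu A.

(** By injectivity the iterated images of the exceptional set are pairwise disjoint. They all have
    its measure and lie in [S], whose measure is finite, so this common measure is zero. Images are
    used instead of preimages because the invariance of the flow is stated for images. *)
Lemma poincare_return (A : set T) : A `<=` S -> measurable A ->
  measurable (A `\` \bigcup_n (iter n.+1 f @` A)) /\
  nu (A `\` \bigcup_n (iter n.+1 f @` A)) = 0%E.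
Proof.
move=> AS mA; set N := _ `\` _.
have iterS n x : S x -> S (iter n f x) by move=> Sx; elim: n => //= n; exact: fS.
have iter_inj n x y : S x -> S y -> iter n f x = iter n f y -> x = y.
  elim: n => //= n IH Sx Sy /f_inj => /(_ (iterS _ _ Sx) (iterS _ _ Sy)).
  exact: IH.
have pres n B : B `<=` S -> measurable B ->
    measurable (iter n f @` B) /\ nu (iter n f @` B) = nu B.
  move=> BS mB; elim: n => [|n [IH1 IH2]].
    by rewrite (_ : iter 0 f = id) ?image_id//; exact/funext.
  rewrite (_ : iter n.+1 f @` B = f @` (iter n f @` B)); last first.
    by rewrite image_comp.
  have [] := @f_pres (iter n f @` B) _ IH1; last by rewrite IH2.
  by move=> _ [x Bx <-]; apply: iterS; exact: BS.
have mN : measurable N.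
  apply: measurableD => //; apply: bigcup_measurable => n _.
  by have [] := pres n.+1 _ AS mA.
split=> //; have NS : N `<=` S by move=> x [/AS].
have lt_disj i j z : (i < j)%N ->
    (iter i f @` N) z -> (iter j f @` N) z -> False.
  move=> ij [x Nx <-] [y Ny]; rewrite -(subnKC ij) addSnnS iterD => eyx.
  case: Nx => Ax; apply; exists (j - i.+1)%N => //; exists y; first by case: Ny.
  by apply: iter_inj eyx; [apply/iterS/NS|apply: AS].
have tN : trivIset setT (fun n => iter n f @` N).
  move=> i j _ _ [z [zi zj]]; case: (ltngtP i j) => // ij.
    by have := lt_disj _ _ _ ij zi zj.
  by have := lt_disj _ _ _ ij zj zi.
have NSle : (nu N <= nu S)%E by apply: le_measure => //; rewrite inE.
have Nfin : nu N \is a fin_num by rewrite ge0_fin_numE// (le_lt_trans NSle).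
have Sfin : nu S \is a fin_num by rewrite ge0_fin_numE.
have bound n : n%:R * fine (nu N) <= fine (nu S).
  rewrite -lee_fin (fineK Sfin).
  have -> : (n%:R * fine (nu N))%:E = (\sum_(k < n) nu (iter k f @` N))%E.
    rewrite (eq_bigr (fun=> (fine (nu N))%:E)); last first.
      by move=> k _; rewrite (pres _ _ NS mN).2 fineK.
    by rewrite sumEFin sumr_const card_ord mulr_natl.
  have mI (k : 'I_n) : measurable (iter k f @` N) by have [] := pres k _ NS mN.
  rewrite -(@measure_bigsetU_ord _ _ _ nu n xpredT (fun k : 'I_n => iter k f @` N))//.
    apply: le_measure; rewrite ?inE//; first exact: bigsetU_measurable.
    rewrite -(bigcup_mkord n (fun k => iter k f @` N)) => z [k _ [x Nx <-]].
    exact/iterS/NS.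
  by move=> i j _ _ [z [zi zj]]; apply/val_inj/tN => //; exists z.
rewrite -(fineK Nfin); congr EFin.
apply/eqP; rewrite eq_le fine_ge0// andbT leNgt; apply/negP => N0.
have := bound (Num.truncn (fine (nu S) / fine (nu N))).+1.
by rewrite -ler_pdivlMr// leNgt Num.Theory.truncnS_gt.
Qed.

End poincare.

(** * Returns of a measure-preserving flow to the sets of a countable cover *)

Section flow_return.
Context d (T : measurableType d) (R : realType).
Variable nu : {measure set T -> \bar R}.
Variables (S : set T) (Phi : R -> T -> T).
Hypothesis mS : measurable S.
Hypothesis nuS : (nu S < +oo)%E.
Hypothesis Phi0 : forall x, S x -> Phi 0 x = x.
Hypothesis PhiS : forall t x, S x -> S (Phi t x).
Hypothesis PhiD : forall s t x, S x -> Phi s (Phi t x) = Phi (s + t) x.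
Hypothesis Phi_pres : forall t A, A `<=` S -> measurable A ->
  measurable (Phi t @` A) /\ nu (Phi t @` A) = nu A.

(** Two points of the same set of the cover are [V]-related, so a return to that set is a return in
    the sense of [V]. Countably many exceptional null sets are discarded, one for each set of the
    cover. *)
Lemma flow_return (A : nat -> set T) (V : T -> T -> Prop) (h : R) :
  (forall k, measurable (A k)) -> (forall k, A k `<=` S) ->
  S `<=` \bigcup_k A k -> (forall k x y, A k x -> A k y -> V x y) ->
  nu.-negligible [set x | S x /\ forall n, ~ V x (Phi (n.+1%:R * h) x)].
Proof.
(* Time runs backwards in [f]: if [x] is the image of [y] in [A k] under [n + 1] iterations of [f],
   then [y] is the point of the orbit of [x] at time $(n+1)h$. *)
move=> mA AS Acov AV; pose f := Phi (- h).
have f_inj x y : S x -> S y -> f x = f y -> x = y.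
  move=> Sx Sy /(congr1 (Phi h)).
  by rewrite /f !PhiD// subrr !Phi0.
have fS x : S x -> S (f x) by exact: PhiS.
have iterE n x : S x -> Phi (n%:R * h) (iter n f x) = x.
  move=> Sx; have iS m : S (iter m f x) by elim: m => //= m; exact: fS.
  elim: n => [|n IH]; first by rewrite mul0r Phi0.
  by rewrite /= /f PhiD// -addn1 natrD mulrDl mul1r addrK.
pose N k := A k `\` \bigcup_n (iter n.+1 f @` A k).
have PN k := @poincare_return _ _ _ nu _ _ mS nuS f_inj fS (Phi_pres (- h)) _
  (AS k) (mA k).
apply: (@negligibleS _ _ _ _ (\bigcup_k N k)).
  move=> x [Sx nVx]; have [k _ Akx] := Acov _ Sx; exists k => //; split => //.
  move=> [n _ [y Aky fyx]]; apply: (nVx n); apply: AV Akx _.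
  by rewrite -fyx iterE//; exact: AS Aky.
apply: negligible_bigcup => k; exists (N k); split => //; by have [] := PN k.
Qed.

End flow_return.

(** * Separability of the space of orbits *)

(** Compactness of $[-P,P]$ makes continuity uniform. The budget [e / 4] pays for comparing both
    times with a common centre: $2(e/4+e/4)=e$. *)
Lemma uniform_continuity_sobolev (R : realType) (s : R) (w : R -> int -> R[i]%C)
    (P e : R) :
  continuous_in_sobolev s w -> 0 < e ->
  exists L : nat, forall t t', `|t| <= P -> `|t' - t| <= L.+1%:R^-1 ->
    (sobolev_energy s (fun n => (w t' n - w t n)%R) <= e%:E)%E.
Proof.
move=> wc e0; pose K := `[- P, P]%classic.
pose Q (L : nat) (t : R) := forall t', `|t' - t| <= L.+1%:R^-1 ->
    (sobolev_energy s (fun n => (w t' n - w t n)%R) <= e%:E)%E.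
have /compact_near_coveringP/(_ _ \oo Q _) := @segment_compact R (- P) P.
case.
  move=> t _; have e40 : 0 < e / 4 by rewrite divr_gt0.
  have [d d0 dP] := continuous_sobolev_energy t wc e40.
  have d20 : 0 < d / 2 by rewrite divr_gt0.
  exists (ball t (d / 2), [set L | (Num.truncn (d / 2)^-1 <= L)%N]) => /=.
    by split; [exact: nbhsx_ballx|exists (Num.truncn (d / 2)^-1)].
  move=> [t1 L] /= [tt1 dL] t2 t12.
  have Ld : L.+1%:R^-1 <= d / 2 :> R.
    rewrite -[leRHS]invrK lef_pV2 ?posrE ?ltr0n ?invr_gt0//.
    by rewrite (le_trans (ltW (Num.Theory.truncnS_gt _)))// ler_nat.
  have t1d : `|t1 - t| <= d / 2 by rewrite distrC ltW.
  have h1 : `|t1 - t| <= d by lra.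
  have h2 : `|t2 - t| <= d.
    rewrite (_ : t2 - t = (t2 - t1) + (t1 - t)); last by ring.
    by rewrite (le_trans (ler_normD _ _))// (splitr d) lerD// (le_trans t12).
  have := dP _ h1; rewrite sobolev_energyC => h3.
  have := sobolev_energy_trans (dP _ h2) h3.
  by rewrite (_ : 2 * _ = e)//; field.
move=> L _ LP; exists L => t t' tP; apply: (LP L) => //=.
by rewrite in_itv/= -ler_norml.
Qed.

Section path_cover.
Context {R : realType}.
Variables (sigma : R) (S : set (torus_dist R)).
Variable Phi : R -> torus_dist R -> torus_dist R.
Variable M : set (set (torus_dist R)).
Hypothesis M_bigcap : forall F : nat -> set (torus_dist R),
  (forall n, M (F n)) -> M (\bigcap_n F n).
Hypothesis M_measurable : forall A, measurable A -> M A.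
Hypothesis mS : measurable S.
Hypothesis Phi0 : forall x, S x -> Phi 0 x = x.
Hypothesis PhiS : forall t x, S x -> S (Phi t x).
Hypothesis PhiD : forall s t x, S x -> Phi s (Phi t x) = Phi (s + t) x.
Hypothesis M_Phi : forall t A, A `<=` S -> M A -> M (Phi t @` A).
Hypothesis Phi_cont : forall x, S x -> continuous_in_sobolev sigma (Phi ^~ x).

(** The group law turns preimages into images, the only operation under which [M] is assumed
    stable. *)
Let preimageE t (B : set (torus_dist R)) :
  [set x | S x /\ B (Phi t x)] = Phi (- t) @` (B `&` S).
Proof.
apply/seteqP; split => [x [Sx Bx]|_ [y [By Sy] <-]] /=.
  exists (Phi t x); first by split => //; exact: PhiS.
  by rewrite PhiD// addNr Phi0.
by split; [exact: PhiS|rewrite PhiD// subrr Phi0].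
Qed.

(** On a compact time interval an orbit is close to a step path with values in a countable dense
    set, and there are countably many such paths. Imposing closeness at rational times only makes
    each set a countable intersection of members of [M]; continuity of orbits in time recovers the
    other times. The class [M] will be that of the Caratheodory sets of [rho^*], on which the flow
    is known to act. *)
Lemma path_cover (P0 : nat) (e : R) : 0 < e ->
  exists A : nat -> set (torus_dist R),
  [/\ forall k, M (A k), forall k, A k `<=` S, S `<=` \bigcup_k A k &
    forall k x y, A k x -> A k y -> forall t, `|t| <= P0%:R ->
      (sobolev_energy sigma (fun n => (Phi t x n - Phi t y n)%R) <= e%:E)%E].
Proof.
(* The final chain has four links of size [e'], whose nested triangle inequalities give
   $2(2+2)$-type growth: 4, then $2(4+1)=10$, then $2(1+10)=22$. *)
move=> e0; pose e' := e / 22; have e'0 : 0 < e' by rewrite divr_gt0.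
have [D DP] := @sobolev_separable R sigma.
(* One unit wider than required, so that a rational time near [t] stays in the window. *)
pose P : R := P0.+1%:R.
have P_0 : 0 < P by rewrite ltr0n.
pose idx (L : nat) (t : R) := Num.truncn ((t + P) * L.+1%:R).
pose B L c (t : R) := [set u : torus_dist R |
  (sobolev_energy sigma (fun n => (u n - D (nth 0%N c (idx L t)) n)%R) <= e'%:E)%E].
pose C L c (q : rat) :=
  [set x | S x /\ (`|ratr q| <= P -> B L c (ratr q) (Phi (ratr q) x))].
(* The sets of the cover: orbits within [e'], at all rational times, of the step
   path with values [D (c_i)] on the mesh of size [1 / (L + 1)]. *)
pose A (Lc : nat * seq nat) := \bigcap_n
  if unpickle n is Some q then C Lc.1 Lc.2 q else S.
have AE Lc x : A Lc x <-> S x /\ forall q : rat, C Lc.1 Lc.2 q x.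
  split => [Ax|[Sx Cx] n _]; last by case: (unpickle n).
  have Cx q : C Lc.1 Lc.2 q x by have := Ax (pickle q) I; rewrite pickleK.
  by split => //; case: (Cx 0).
have MC L c q : M (C L c q).
  rewrite /C; case: (boolP (`|ratr q| <= P)) => qP.
    rewrite [X in M X](_ : _ = Phi (- ratr q) @` (B L c (ratr q) `&` S)).
      apply: M_Phi => //; apply: M_measurable; apply: measurableI => //.
      exact: measurable_sobolev_ball.
    rewrite -preimageE; apply/seteqP; split => x [Sx Bx]; split => //.
    exact: Bx.
  rewrite [X in M X](_ : _ = S); first exact: M_measurable.
  by apply/seteqP; split => [x []//|x Sx]; split.
have MA Lc : M (A Lc).
  by apply: M_bigcap => n; case: (unpickle n) => // ; exact: M_measurable.
exists (fun k => A (odflt (0%N, [::]) (unpickle k))); split.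
- by move=> k; exact: MA.
- by move=> k x /AE[].
- move=> x Sx.
  have e'4 : 0 < e' / 4 by rewrite divr_gt0.
  have [L LP] := uniform_continuity_sobolev P (Phi_cont Sx) e'4.
  (* The left end of the mesh interval of index [i]; the dense family is matched to the orbit at
     these finitely many times. *)
  pose tau (i : nat) : R := i%:R / L.+1%:R - P.
  have /choice[f fP] : forall i : nat, exists k : nat,
      (sobolev_energy sigma (fun n => (Phi (tau i) x n - D k n)%R) <= (e' / 4)%:E)%E.
    by move=> i; apply: DP => //; apply: in_sobolevP; case: (Phi_cont Sx).
  pose N := Num.truncn (2 * P * L.+1%:R).
  pose c := mkseq f N.+1.
  exists (pickle (L, c)) => //; rewrite pickleK /=; apply/AE; split => // q.
  split => // qP /=; rewrite /B /=.
  set t : R := ratr q in qP *.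
  have tP0 : 0 <= t + P <= 2 * P by move: qP; rewrite ler_norml => /andP[? ?]; lra.
  have tL0 : 0 <= (t + P) * L.+1%:R by rewrite mulr_ge0//; case/andP: tP0.
  have iN : (idx L t < N.+1)%N.
    rewrite ltnS; apply: Num.Theory.le_truncn; rewrite ler_pM2r//.
    by case/andP: tP0.
  rewrite nth_mkseq//.
  have /andP[i1 i2] := Num.Theory.truncn_itv tL0.
  rewrite -/(idx L t) in i1 i2.
  have L0 : (0 : R) < L.+1%:R by rewrite ltr0n.
  have tau1 : tau (idx L t) <= t.
    by rewrite /tau lerBlDr ler_pdivrMr.
  have tau2 : t - tau (idx L t) <= L.+1%:R^-1.
    rewrite -(ler_pM2r L0) mulVf ?gt_eqF// /tau opprB mulrDl mulrBl.
    rewrite divfK ?gt_eqF//; move: i2; rewrite -addn1 natrD mulrDl; lra.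
  have tauP : `|tau (idx L t)| <= P.
    have tau0 : 0 <= (idx L t)%:R / L.+1%:R :> R by rewrite divr_ge0.
    rewrite ler_norml; apply/andP; split; first by rewrite /tau lerBrDl subrr.
    by rewrite (le_trans tau1)//; move: qP; rewrite ler_norml => /andP[].
  have h1 := LP _ t tauP.
  have h2 : `|t - tau (idx L t)| <= L.+1%:R^-1 by rewrite ger0_norm// subr_ge0.
  have := sobolev_energy_trans (h1 h2) (fP (idx L t)).
  by rewrite (_ : 2 * _ = e')//; field.
- move=> k x y /AE[Sx Cx] /AE[Sy Cy] t tP.
  have [d1 d10 d1P] := continuous_sobolev_energy t (Phi_cont Sx) e'0.
  have [d2 d20 d2P] := continuous_sobolev_energy t (Phi_cont Sy) e'0.
  (* A rational time within [d] of [t] is suitable for both orbits, and the bound 1 keeps it in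
     $[-P,P]$. *)
  pose d := Num.min d1 (Num.min d2 1).
  have d0 : 0 < d by rewrite !lt_min d10 d20/=.
  have [q] := @rat_in_itvoo R t (t + d) ltac:(lra).
  rewrite in_itv/= => /andP[tq qtd].
  set r : R := ratr q in tq qtd.
  have rt : `|r - t| <= d by rewrite ger0_norm ?subr_ge0 ?ltW// ltrBlDl.
  have dd : [/\ d <= d1, d <= d2 & d <= 1].
    by rewrite /d !ge_min !lexx ?orbT.
  have [dd1 dd2 dd3] := dd.
  have rP : `|r| <= P.
    rewrite (_ : r = t + (r - t)); last by ring.
    by rewrite (le_trans (ler_normD _ _))// /P -addn1 natrD lerD// (le_trans rt).
  have [_ /(_ rP) Bx] := Cx q; have [_ /(_ rP) By] := Cy q.
  have := d1P r (le_trans rt dd1); rewrite sobolev_energyC => hx.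
  have hy := d2P r (le_trans rt dd2).
  rewrite /B /= sobolev_energyC in By.
  have := sobolev_energy_trans hx
    (sobolev_energy_trans (sobolev_energy_trans Bx By) hy).
  by rewrite (_ : 2 * _ = e)//; rewrite /e'; field.
Qed.

End path_cover.

(** * Return times modulo t *)

Section return_times.
Context {R : realType}.
(* [C e a b]: the points of the orbit at times [a] and [b] are [e]-close. *)
Variable C : R -> R -> R -> Prop.
Hypothesis C_mono : forall (e e' a b : R), e <= e' -> C e a b -> C e' a b.
Hypothesis C_refl : forall (e a : R), 0 <= e -> C e a a.
Hypothesis C_trans : forall (e e' a b c : R),
  C e a b -> C e' b c -> C (2 * (e + e')) a c.
Hypothesis C_cont : forall e : R, 0 < e ->
  exists2 d : R, 0 < d & forall s : R, `|s| <= d -> C e s 0.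
Hypothesis C_rec : forall (e M : R) (K : nat), 0 < e ->
  exists2 n : nat, (K <= n)%N & forall s : R, `|s| <= M -> C e (s + n%:R) s.

(* The integers [T (j + 1) - T j] are chosen successively, the next one being a
   return time for the stretch of orbit covered so far. *)
Lemma return_time_chain (e : R) (J K : nat) : 0 < e ->
  exists T : nat -> nat, forall i k, (i + k <= J)%N ->
    (k * K <= T (i + k) - T i)%N /\
    (T i <= T (i + k)%N)%N /\
    forall s : R, `|s| <= 1 -> C e (s + ((T (i + k)%N)%:R - (T i)%:R)) s.
Proof.
(* Each link multiplies the error by at most 4, since $2(e'+4^k e')\le 4^{k+1}e'$, and there are at
   most [J] links. *)
move=> e0; pose e' := e / 4 ^+ J.
have e'0 : 0 < e' by rewrite divr_gt0// exprn_gt0.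
have /choice[f fP] : forall M : nat, exists n : nat, (K <= n)%N /\
    forall s : R, `|s| <= M%:R -> C e' (s + n%:R) s.
  by move=> M; have [n Kn nP] := C_rec M%:R K e'0; exists n.
(* The window [T m + 1] contains every time $s+(T_m-T_i)$ with $|s|\le1$ and $i\le m$, so the next
   return applies after all earlier shifts. *)
pose T := fix T n := if n is m.+1 then (T m + f (T m).+1)%N else 0%N.
exists T => i k ikJ.
suff [H1 [H2 H3]] : (k * K <= T (i + k) - T i)%N /\ (T i <= T (i + k)%N)%N /\
    forall s : R, `|s| <= 1 ->
      C (4 ^+ k * e') (s + ((T (i + k)%N)%:R - (T i)%:R)) s.
  split => //; split => // s /H3; apply: C_mono.
  rewrite /e' mulrCA; apply: ler_piMr; first exact: ltW.
  rewrite ler_pdivrMr ?exprn_gt0// mul1r.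
  by rewrite ler_weXn2l ?ler1n//; lia.
elim: k {ikJ} => [|k [H1 [H2 H3]]].
  rewrite addn0 subnn; split => //; split => // s _.
  by rewrite subrr addr0; apply: C_refl; rewrite mulr_ge0 ?ltW// exprn_ge0.
rewrite addnS /=; have [fK fC] := fP (T (i + k)%N).+1.
split; first by nia.
split; first by lia.
move=> s s1; have s1' := H3 _ s1.
have -> : s + ((T (i + k)%N + f (T (i + k)%N).+1)%N%:R - (T i)%:R) =
  (s + ((T (i + k)%N)%:R - (T i)%:R)) + (f (T (i + k)%N).+1)%:R :> R.
  by rewrite natrD; ring.
apply: C_mono (C_trans (fC _ _) s1'); last first.
  rewrite (le_trans (ler_normD _ _))// -natrB// normr_nat.
  by rewrite -addn1 natrD addrC lerD// ler_nat leq_subr.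
rewrite exprS; have : 1 <= (4 : R) ^+ k by rewrite exprn_ege1// ler1n.
by move=> h; nra.
Qed.

(** The [J + 1] fractional parts of $T_i/t$ fall into [J] boxes of width $1/J$; two indices in one
    box give the claim, [p] being the difference of the integer parts. *)
Lemma pigeonhole_mod (t : R) (J : nat) (T : nat -> nat) : 0 < t -> (0 < J)%N ->
  exists i k : nat, exists p : int, [/\ (0 < k)%N, (i + k <= J)%N &
    `|(T (i + k)%N)%:R - (T i)%:R - p%:~R * t| <= t / J%:R].
Proof.
move=> t0 J0; pose y i : R := (T i)%:R / t - (Num.floor ((T i)%:R / t))%:~R.
have y01 i : 0 <= y i < 1.
  rewrite /y subr_ge0 ltrBlDl; have := floor_itv ((T i)%:R / t : R).
  by rewrite intrD => /andP[-> ->].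
have J0R : (0 : R) < J%:R by rewrite ltr0n.
have bP i : (Num.truncn (y i * J%:R) < J)%N.
  have /andP[y0 y1] := y01 i.
  rewrite -(ltr_nat R) (@le_lt_trans _ _ (y i * J%:R))//.
    by rewrite Num.Theory.truncn_le// mulr_ge0// ltW.
  by rewrite gtr_pMl.
pose b (i : 'I_J.+1) : 'I_J := Ordinal (bP i).
have [i [j [ij bij]]] : exists i j : 'I_J.+1, (i < j)%N /\ b i = b j.
  apply: contrapT => H.
  have /leq_card : injective b.
    move=> i j bij; apply/val_inj => /=; case: (ltngtP i j) => // ij.
      by case: H; exists i, j.
    by case: H; exists j, i.
  by rewrite !card_ord ltnn.
have {}bij : Num.truncn (y i * J%:R) = Num.truncn (y j * J%:R).
  by have /(congr1 val) := bij.
have jJ : (j <= J)%N by have := ltn_ord j; rewrite ltnS.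
exists i, (j - i)%N, (Num.floor ((T j)%:R / t) - Num.floor ((T i)%:R / t)).
split; [by rewrite subn_gt0|by rewrite subnKC// ltnW|].
rewrite subnKC ?(ltnW ij)//.
have -> : (T j)%:R - (T i)%:R -
   (Num.floor ((T j)%:R / t) - Num.floor ((T i)%:R / t))%:~R * t =
   (y j - y i) * t.
  by rewrite /y intrB; field; rewrite gt_eqF.
rewrite normrM (gtr0_norm t0) [leRHS]mulrC ler_pM2r// -[leRHS]mul1r.
rewrite ler_pdivlMr// -[X in _ * X]gtr0_norm// -normrM mulrBl.
have /andP[yi0 yi1] := y01 i; have /andP[yj0 yj1] := y01 j.
have := Num.Theory.truncn_itv (mulr_ge0 yi0 (ltW J0R)).
have := Num.Theory.truncn_itv (mulr_ge0 yj0 (ltW J0R)).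
rewrite bij -(addn1 (Num.truncn _)) natrD => /andP[? ?] /andP[? ?].
by rewrite ler_norml; apply/andP; split; lra.
Qed.

(** Some difference of the chain is $pt+r$ with [r] small. Since the chain controls all starting
    times $|s|\le1$, starting at $s=-r$ lands exactly at $pt$; continuity at time 0 then replaces
    $-r$ by 0. *)
Lemma return_multiple (t e : R) (K : nat) : 0 < t -> 0 < e ->
  exists2 p : nat, (K <= p)%N & C e (p%:R * t) 0.
Proof.
move=> t0 e0.
have e40 : 0 < e / 4 by rewrite divr_gt0.
have [d0 d00 dC'] := C_cont e40.
pose d := Num.min d0 1.
have d_0 : 0 < d by rewrite lt_min d00/=.
have d1 : d <= 1 by rewrite ge_min lexx orbT.
have dC s : `|s| <= d -> C (e / 4) s 0.
  by move=> sd; apply: dC'; rewrite (le_trans sd)// ge_min lexx.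
pose J := (Num.truncn (t / d)).+1.
have Jd : t / J%:R <= d.
  rewrite ler_pdivrMr ?ltr0n// mulrC -ler_pdivrMr//.
  exact/ltW/Num.Theory.truncnS_gt.
(* The extra 1 absorbs the remainder $|r|\le d\le1$, so that $pt\ge K'-1\ge tK$. *)
pose K' := (Num.truncn (t * K%:R + 1)).+1.
have K'P : t * K%:R + 1 <= K'%:R by exact/ltW/Num.Theory.truncnS_gt.
have [T TP] := return_time_chain J K' e40.
have [i [k [p [k0 ikJ pP]]]] := @pigeonhole_mod t J T t0 isT.
have [H1 [H2 H3]] := TP _ _ ikJ.
have pd := le_trans pP Jd.
have pK : K%:R <= p%:~R :> R.
  rewrite -(ler_pM2r t0).
  have : K'%:R <= (T (i + k)%N)%:R - (T i)%:R :> R.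
    by rewrite -natrB// ler_nat; nia.
  by move: pd; rewrite ler_norml => /andP[? ?] ?; lra.
have p0 : (0 <= p)%R by rewrite -(ler0z R) (le_trans _ pK)// ler0n.
exists `|p|%N; first by rewrite -(ler_nat R) natr_absz ger0_norm.
rewrite natr_absz ger0_norm//.
set r := (_ - _ - _) in pd.
have -> : p%:~R * t = - r + ((T (i + k)%N)%:R - (T i)%:R) by rewrite /r; ring.
have rd : `| - r| <= d by rewrite normrN.
apply: C_mono (C_trans (H3 _ (le_trans rd d1)) (dC _ rd)).
by lra.
Qed.

End return_times.

(** * Recurrence of the Gibbs flow *)

(** Measurable covers of mass at most $1/(k+1)$ are intersected over [k]. This brings null sets of
    the completed measure back to [rho]. *)
Lemma mu_ext_eq0_negligible d (T : measurableType d) (R : realType)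
    (rho : {measure set T -> \bar R}) (N : set T) :
  (rho^*)%mu N = 0%E -> rho.-negligible N.
Proof.
move=> N0.
have /choice[B BP] : forall k : nat, exists B : set T,
    [/\ measurable B, N `<=` B & (rho B <= (k.+1%:R^-1)%:E)%E].
  move=> k; have fin : (rho^*)%mu N \is a fin_num by rewrite N0.
  have k0 : 0 < k.+1%:R^-1 :> R by rewrite invr_gt0.
  have [_ [A [mA NA] <-]] := lb_ereal_inf_adherent k0 fin.
  rewrite -/((rho^*)%mu N) N0 add0e => Ak.
  exists (\bigcup_i A i); split => //; first exact: bigcupT_measurable.
  apply: le_trans (ltW Ak); apply: measure_sigma_subadditive => //.
  exact: bigcupT_measurable.
exists (\bigcap_k B k); split.
- by apply: bigcapT_measurable => k; have [] := BP k.
- apply/eqP; rewrite eq_le measure_ge0 andbT.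
  apply/lee_addgt0Pr => e e0; rewrite add0e.
  pose k := Num.truncn e^-1; have [mB _ Bk] := BP k.
  apply: (@le_trans _ _ (rho (B k))).
    apply: le_measure; rewrite ?inE//.
      by apply: bigcapT_measurable => i; have [] := BP i.
    exact: bigcap_inf.
  apply: (le_trans Bk); rewrite lee_fin -[leRHS]invrK lef_pV2 ?posrE ?invr_gt0//.
  exact/ltW/Num.Theory.truncnS_gt.
- by move=> x Nx k _; have [_ + _] := BP k; apply.
Qed.

Lemma subsequence_cvg0 (R : realType) (s : R) (w : nat -> int -> R[i]%C) :
  (forall (e : R) (K : nat), 0 < e -> exists2 p : nat, (K <= p)%N &
     (sobolev_energy s (w p) <= e%:E)%E) ->
  exists n_ : nat -> nat,
      [/\ (0 < n_ 0)%N, {homo n_ : j k / (j < k)%N} &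
        sobolev_norm s (w (n_ k)) @[k --> \oo] --> 0%E].
Proof.
move=> H.
have /choice[f fP] : forall kK : nat * nat, exists p : nat, (kK.2 <= p)%N /\
    (sobolev_energy s (w p) <= (kK.1.+1%:R^-1)%:E)%E.
  by move=> [k K]; have [|p] := H k.+1%:R^-1 K; [rewrite invr_gt0|exists p].
(* The lower bound passed to [f] is one more than the previous index, which forces strict growth;
   starting with 1 makes [n_ 0] positive. *)
pose n_ := fix n_ k := if k is m.+1 then f (k, (n_ m).+1) else f (0%N, 1%N).
exists n_; split.
- by have [] := fP (0%N, 1%N).
- apply: homo_ltn; first exact: ltn_trans.
  by move=> i; have [] := fP (i.+1, (n_ i).+1).
- apply: (@sobolev_norm_cvg0P R s (fun k => w (n_ k))) => -[|k].
    by have [] := fP (0%N, 1%N).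
  by have [] := fP (k.+1, (n_ k).+1).
Qed.

Lemma orbit_recurrence (R : realType) (sigma : R) (phi : R -> int -> R[i]%C)
    (t : R) :
  continuous_in_sobolev sigma phi ->
  (forall (e M : R) (K : nat), 0 < e -> exists2 n : nat, (K <= n)%N &
     forall s : R, `|s| <= M ->
       (sobolev_energy sigma (fun m => (phi (s + n%:R) m - phi s m)%R) <= e%:E)%E) ->
  0 < t ->
  forall (e : R) (K : nat), 0 < e -> exists2 p : nat, (K <= p)%N &
     (sobolev_energy sigma (fun m => (phi (p%:R * t) m - phi 0 m)%R) <= e%:E)%E.
Proof.
move=> phic phirec t0 e K e0.
apply: (@return_multiple R (fun e a b =>
  (sobolev_energy sigma (fun m => (phi a m - phi b m)%R) <= e%:E)%E)) => //.
- by move=> e1 e2 a b e12 /le_trans; apply; rewrite lee_fin.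
- by move=> e1 a e10; rewrite sobolev_energy_subrr lee_fin.
- by move=> e1 e2 a b c; exact: sobolev_energy_trans.
- move=> e1 e10; have [d d0 dP] := continuous_sobolev_energy 0 phic e10.
  by exists d => // s sd; apply: dP; rewrite subr0.
Qed.

Section gibbs_flow_recurrence.
Context {R : realType}.
Variables (alpha sigma : R) (rho : {measure set (torus_dist R) -> \bar R}).
Variables (S : set (torus_dist R)) (Phi : R -> torus_dist R -> torus_dist R).
Hypothesis flow : gibbs_flow alpha sigma rho S Phi.
Hypothesis rho_fin : (rho setT < +oo)%E.

Let Phi_solves x : S x -> solves alpha sigma x (Phi ^~ x).
Proof. by move=> /(flow_solution flow)[s [b [_ _ [sol _] _ _]]]. Qed.

Let Phi0 x : S x -> Phi 0 x = x.
Proof. by move=> /Phi_solves/solves_init. Qed.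

Let Phi_cont x : S x -> continuous_in_sobolev sigma (Phi ^~ x).
Proof. by move=> /Phi_solves/solves_cont. Qed.

Let PhiS t x : S x -> S (Phi t x).
Proof. by move=> Sx; rewrite -(flow_image flow t); exists x. Qed.

Let PhiD s t x : S x -> Phi s (Phi t x) = Phi (s + t) x.
Proof. exact: (flow_group flow). Qed.

(** The flow is only known to preserve sets measurable for the completion of [rho], so Poincare
    recurrence is applied to the completed measure [nu] on this type. *)
Let U : measurableType _ := caratheodory_type (rho^*)%mu.
Let nu : {measure set U -> \bar R} := @completed_measure_extension _ _ _ rho.

(** Recurrence for the relation of having orbits [e]-close on the whole window $|s|\le P$, with the
    countable cover given by [path_cover]. *)
Lemma almost_path_recurrence (P : nat) (e h : R) : 0 < e ->
  rho.-negligible [set x | S x /\ forall n : nat, ~ forall s, `|s| <= P%:R ->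
    (sobolev_energy sigma
      (fun m => (Phi (s + n.+1%:R * h) x m - Phi s x m)%R) <= e%:E)%E].
Proof.
move=> e0; have mS := flow_measurable flow.
have mcara (A : set (torus_dist R)) : measurable A -> (rho^*)%mu.-caratheodory A.
  exact: caratheodory_measurable_mu_ext.
have [A [mA AS Acov AP]] := @path_cover R sigma S Phi (rho^*)%mu.-caratheodory
  (fun F mF => @bigcapT_measurable _ U F mF) mcara mS Phi0 PhiS PhiD
  (fun t A AS mA => proj1 (flow_invariant flow t AS mA)) Phi_cont P e e0.
have nuS : (nu S < +oo)%E.
  change ((rho^*)%mu S < +oo)%E.
  rewrite measurable_mu_extE// (le_lt_trans _ rho_fin)//.
  by apply: le_measure; rewrite ?inE.
have := @flow_return _ U R nu S Phi (mcara _ mS) nuS Phi0 PhiS PhiD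
  (fun t A AS mA => flow_invariant flow t AS mA) A
  (fun x y => forall t, `|t| <= P%:R -> (sobolev_energy sigma
     (fun n => (Phi t y n - Phi t x n)%R) <= e%:E)%E) h mA AS Acov
  (fun k x y Ax Ay => AP k y x Ay Ax).
case=> N [mN N0 subN].
apply: negligibleS (mu_ext_eq0_negligible N0).
move=> x [Sx nx]; apply: subN; split => // n nV; apply: (nx n) => s sP.
by have := nV s sP; rewrite PhiD.
Qed.

(** Only countably many windows, tolerances and integer time steps of both signs are used to build
    the null set. Outside it, every real [t] is handled by the deterministic argument on a single
    orbit. *)
Lemma almost_flow_recurrence : rho.-negligible [set x | S x /\
  ~ forall t : R, exists n_ : nat -> nat,
      [/\ (0 < n_ 0)%N, {homo n_ : j k / (j < k)%N} &
        sobolev_norm sigma (fun m : int => Phi ((n_ k)%:R * t) x m - x m)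
          @[k --> \oo] --> 0%E]].
Proof.
(* The index [((P, k), (K, b))] stands for the window [P], the tolerance $1/(k+1)$ and the time step
   $\pm(K+1)$ with sign [b]. *)
pose bad (i : (nat * nat) * (nat * bool)) := [set x | S x /\ forall n : nat, ~ forall s,
  `|s| <= i.1.1%:R -> (sobolev_energy sigma (fun m => (Phi (s + n.+1%:R *
     ((-1) ^+ i.2.2 * i.2.1.+1%:R)) x m - Phi s x m)%R) <= (i.1.2.+1%:R^-1)%:E)%E].
apply: (@negligibleS _ _ _ _
  (\bigcup_k bad (odflt ((0, 0), (0, false))%N (unpickle k)))); last first.
  apply: negligible_bigcup => k; apply: almost_path_recurrence.
  by rewrite invr_gt0.
move=> x [Sx nx]; apply: contrapT => nbad; apply: nx.
have good (i : (nat * nat) * (nat * bool)) : exists n : nat, forall s,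
  `|s| <= i.1.1%:R -> (sobolev_energy sigma (fun m => (Phi (s + n.+1%:R *
     ((-1) ^+ i.2.2 * i.2.1.+1%:R)) x m - Phi s x m)%R) <= (i.1.2.+1%:R^-1)%:E)%E.
  apply: contrapT => H; apply: nbad; exists (pickle i) => //; rewrite pickleK.
  by split => // n nP; apply: H; exists n.
have Phic := Phi_cont Sx.
have x0 := Phi0 Sx.
have rec (b : bool) (e M : R) (K : nat) : 0 < e -> exists2 n : nat, (K <= n)%N &
     forall s : R, `|s| <= M ->
       (sobolev_energy sigma (fun m => (Phi ((-1) ^+ b * (s + n%:R)) x m
          - Phi ((-1) ^+ b * s) x m)%R) <= e%:E)%E.
  move=> e0; pose k := Num.truncn e^-1; pose P := (Num.truncn M).+1.
  have [n nP] := good ((P, k), (K, b)).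
  (* The return time is a positive multiple of the step [K + 1], hence at least [K]. *)
  exists (n.+1 * K.+1)%N; first by rewrite mulSn; lia.
  move=> s sM; have := nP ((-1) ^+ b * s).
  rewrite normrM normrX normrN1 expr1n mul1r => nP'.
  have {}nP' := nP' (le_trans sM (ltW (Num.Theory.truncnS_gt M))); move: nP'.
  rewrite mulrDr natrM mulrCA => /le_trans; apply.
  rewrite lee_fin -[leRHS]invrK lef_pV2 ?posrE ?invr_gt0//.
  exact/ltW/Num.Theory.truncnS_gt.
have cont b : continuous_in_sobolev sigma (fun t => Phi ((-1) ^+ b * t) x).
  split; first by move=> t; apply: Phic.1.
  move=> t; apply: (@cvg_comp _ _ _ (fun t' => (-1) ^+ b * t')
    (fun t' => sobolev_norm sigma
       (fun n => (Phi t' x n - Phi ((-1) ^+ b * t) x n)%R))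
    _ (nbhs ((-1) ^+ b * t))); last exact: Phic.2.
  by apply: cvgMr; exact: cvg_id.
have recur (b : bool) (t : R) : 0 < t ->
  forall (e : R) (K : nat), 0 < e -> exists2 p : nat, (K <= p)%N &
     (sobolev_energy sigma
       (fun m => (Phi (p%:R * ((-1) ^+ b * t)) x m - x m)%R) <= e%:E)%E.
  move=> t0 e K e0.
  have [p Kp] := orbit_recurrence (cont b) (rec b) t0 K e0.
  by rewrite mulr0 x0 mulrCA => ?; exists p.
move=> t; apply: (@subsequence_cvg0 R sigma (fun p m => Phi (p%:R * t) x m - x m)).
(* For negative [t] the result for positive times is applied to the reversed orbit; for [t = 0]
   nothing moves. *)
move=> e K e0; case: (ltgtP t 0) => t0.
- have nt0 : 0 < - t by rewrite oppr_gt0.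
  have [p Kp] := recur true _ nt0 e K e0.
  by rewrite expr1 mulN1r opprK; exists p.
- by have [p Kp] := recur false _ t0 e K e0; rewrite expr0 mul1r; exists p.
- exists K => //; rewrite t0 mulr0 x0 sobolev_energy_subrr lee_fin; exact: ltW.
Qed.

End gibbs_flow_recurrence.

(** * Integrals and densities *)

Import HBNNSimple.

Section nonmeasurable_integral.
Context d (T : measurableType d) (R : realType).
Local Open Scope ereal_scope.

(* Unlike [ge0_le_integral], no measurability is required, since the integral of
   a nonnegative function is a supremum over the simple functions below it. *)
Lemma ge0_le_integral_sup (mu : {measure set T -> \bar R}) (D : set T)
    (f g : T -> \bar R) :
  (forall x, D x -> 0 <= f x) -> (forall x, D x -> f x <= g x) ->
  \int[mu]_(x in D) f x <= \int[mu]_(x in D) g x.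
Proof.
move=> f0 fg; rewrite !ge0_integralE//; last first.
  by move=> x Dx; rewrite (le_trans (f0 _ Dx))// fg.
apply: ereal_sup_le => _ [h hf <-]; exists h => // x.
apply: (le_trans (hf x)); rewrite !patchE; case: ifPn => // /[!inE].
exact: fg.
Qed.

(** A simple function below [f] is integrated over its level sets, where [nu] is given by the
    density; the result is the [mu]-integral of that function times [p]. *)
Lemma ge0_integral_density_le (mu nu : {measure set T -> \bar R})
    (p : T -> R) (f : T -> \bar R) :
  (forall x, (0 <= p x)%R) -> measurable_fun setT p ->
  (forall A, measurable A -> nu A = \int[mu]_(x in A) (p x)%:E) ->
  (forall x, 0 <= f x) ->
  \int[nu]_x f x <= \int[mu]_x (f x * (p x)%:E).
Proof.
move=> p0 mp nuE f0; rewrite ge0_integralTE//.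
apply: ge_ereal_sup => _ [h hf <-].
rewrite sintegralE.
have mh r : measurable (h @^-1` [set r]).
  by rewrite -[X in measurable X]setTI; exact: (measurable_funP h).
have -> : \sum_(r \in range h) (r%:E * nu (h @^-1` [set r])) =
   \sum_(r \in range h) \int[mu]_x ((r * \1_(h @^-1` [set r]) x * p x)%:E).
  apply: eq_fsbigr => r /[!inE] -[x _ hx].
  rewrite nuE//= -ge0_integralZl//=; last first.
  - by rewrite lee_fin -hx.
  - by move=> y _; rewrite lee_fin.
  - by apply/measurable_EFinP; exact: measurable_funTS.
  rewrite integral_mkcond; apply: eq_integral => y _.
  rewrite patchE indicE; case: ifPn => _; first by rewrite mulr1 EFinM.
  by rewrite mulr0 mul0r.
have term0 r x : 0 <= (r * \1_(h @^-1` [set r]) x * p x)%:E.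
  rewrite lee_fin mulr_ge0// indicE; case: (boolP (x \in _)) => [/[!inE] <-|_].
    by rewrite mulr1.
  by rewrite mulr0.
rewrite -ge0_integral_fsum//=; last first.
  move=> r; apply/measurable_EFinP; apply: measurable_funM => //.
  by apply: measurable_funM => //; exact: measurable_indic.
apply: ge0_le_integral_sup => x _.
  by apply: fsume_ge0 => r _; exact: term0.
rewrite fsumEFin// -mulr_fsuml -fimfunE EFinM.
by apply: lee_wpmul2r; [rewrite lee_fin|exact: hf].
Qed.

(** On [A] the function [h] vanishes almost everywhere, and its zero set is null. It will be applied
    with [h] a measurable minorant of the Gibbs density. *)
Lemma null_of_integral_eq0 (mu : {measure set T -> \bar R}) (A : set T)
    (h : T -> \bar R) :
  measurable A -> measurable_fun setT h -> (forall x, 0 <= h x) ->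
  \int[mu]_(x in A) h x = 0 -> mu [set x | h x = 0] = 0 -> mu A = 0.
Proof.
move=> mA mh h0 intA0 muh0.
have : {ae mu, forall x, A x -> h x = 0}.
  apply/(ae_eq_integral_abs mu mA _).1; first exact: measurable_funTS.
  by under eq_integral do rewrite gee0_abs//.
case=> N [mN N0 subN].
have mh0 : measurable [set x | h x = 0].
  rewrite -[X in measurable X]setTI; apply: (mh measurableT [set 0]).
  exact: emeasurable_set1.
apply/eqP; rewrite eq_le measure_ge0 andbT.
apply: (@le_trans _ _ (mu (N `|` [set x | h x = 0]))).
  apply: le_measure; rewrite ?inE//; first exact: measurableU.
  move=> x Ax; have [h0x|h0x] := pselect (h x = 0); first by right.
  by left; apply: subN => /= /(_ Ax).
by rewrite (le_trans (measureU2 _ mN mh0))//= N0 muh0 adde0.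
Qed.

End nonmeasurable_integral.

(** * The normal law *)

(** The pushforward bundled as a measure, as uniqueness theorems require; it is transparent so that
    it unfolds to [pushforward]. *)
Definition image_measure d d' (T1 : measurableType d) (T2 : measurableType d')
    (R : realFieldType) (m : {measure set T1 -> \bar R}) (f : T1 -> T2)
    (mf : measurable_fun [set: T1] f) : {measure set T2 -> \bar R}.
Proof. by unshelve refine (pushforward m f : {measure set T2 -> \bar R}). Defined.

Section normal_law.
Context {R : realType}.
Notation leb := (@lebesgue_measure R).

Lemma lebesgue_measure_oppr (A : set R) : measurable A ->
  leb (-%R @^-1` A) = leb A.
Proof.
move=> mA.
have mopp : measurable_fun [set: measurableTypeR R]
  (-%R : measurableTypeR R -> measurableTypeR R) by exact: oppr_measurable.
pose mu' := image_measure leb mopp.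
rewrite -[LHS]/(mu' A) -(@lebesgue_measure_unique R mu')// => X.
move=> /ocitvP[->|[[a b] /= ab ->]].
  by rewrite /= /pushforward preimage_set0 !measure0.
rewrite /= /pushforward (_ : _ @^-1` _ = `[- b, - a[%classic); last first.
  by apply/seteqP; split => x /=; rewrite !in_itv/= lerNl ltrNr andbC.
by rewrite !lebesgue_measure_itv/= !lte_fin ltrN2 ab -!EFinB opprK addrC.
Qed.

Lemma normal_prob_oppr (s : R) (A : set R) : s != 0 -> measurable A ->
  normal_prob 0 s (-%R @^-1` A) = normal_prob 0 s A.
Proof.
move=> s0 mA; have mopp : measurable_fun [set: measurableTypeR R]
  (-%R : measurableTypeR R -> measurableTypeR R) by exact: oppr_measurable.
pose mu' := image_measure leb mopp.
transitivity (\int[mu']_(x in A) (normal_pdf 0 s x)%:E)%E; last first.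
  apply: eq_measure_integral => B mB BA; exact: lebesgue_measure_oppr.
rewrite /mu' ge0_integral_pushforward//=; last 2 first.
- apply: measurable_funTS; apply/measurable_EFinP; exact: measurable_normal_pdf.
- by move=> x _; rewrite lee_fin normal_pdf_ge0.
apply: eq_integral => x _ /=.
by rewrite !normal_pdfE// /normal_fun !subr0 sqrrN.
Qed.

(** The product of $x^4$ and the density of variance $s^2$ is dominated by a constant times the
    density of variance $2s^2$, whose integral is 1. *)
Lemma normal_prob_fourth_moment (s : R) : s != 0 ->
  (\int[normal_prob 0%R s]_x (x ^+ 4)%:E < +oo)%E.
Proof.
move=> s0; have s2 : 0 < s ^+ 2 by rewrite exprn_even_gt0.
pose s' := Num.sqrt (2 * s ^+ 2).
have s'2 : s' ^+ 2 = 2 * s ^+ 2 by rewrite sqr_sqrtr// mulr_ge0// ltW.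
have s'0 : s' != 0 by rewrite gt_eqF// sqrtr_gt0 mulr_gt0.
have ps : 0 < normal_peak s by exact: normal_peak_gt0.
have ps' : 0 < normal_peak s' by exact: normal_peak_gt0.
pose c := 64 * s ^+ 4 * normal_peak s / normal_peak s'.
have c0 : 0 <= c.
  apply: divr_ge0; last exact: ltW.
  by apply: mulr_ge0; [rewrite mulr_ge0// exprn_even_ge0|exact: ltW].
apply: le_lt_trans.
  apply: (@ge0_integral_density_le _ _ R leb (normal_prob 0 s) (normal_pdf 0 s)).
  - exact: normal_pdf_ge0.
  - exact: measurable_normal_pdf.
  - by [].
  - by move=> x; rewrite lee_fin exprn_even_ge0.
apply: (@le_lt_trans _ _ (\int[leb]_x (c%:E * (normal_pdf 0 s' x)%:E))%E).
  apply: ge0_le_integral_sup => x _.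
    by rewrite mule_ge0// lee_fin ?exprn_even_ge0// normal_pdf_ge0.
  rewrite -!EFinM lee_fin !normal_pdfE// /normal_fun !subr0.
  have -> : c * (normal_peak s' * expR (- x ^+ 2 / (s' ^+ 2 *+ 2))) =
            64 * s ^+ 4 * normal_peak s * expR (- x ^+ 2 / (s' ^+ 2 *+ 2)).
    by rewrite /c; field; rewrite gt_eqF.
  rewrite mulrCA [leRHS](_ : _ = normal_peak s *
    (64 * s ^+ 4 * expR (- x ^+ 2 / (s' ^+ 2 *+ 2)))); last by ring.
  rewrite ler_pM2l//.
  pose y := x ^+ 2 / (4 * s ^+ 2).
  have -> : - x ^+ 2 / (s ^+ 2 *+ 2) = - (2 * y).
    by rewrite /y -mulr_natr; field.
  have -> : - x ^+ 2 / (s' ^+ 2 *+ 2) = - y.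
    by rewrite /y -mulr_natr s'2; field.
  have y0 : 0 <= y by rewrite /y divr_ge0 ?sqr_ge0// mulr_ge0// ltW.
  have xy : x ^+ 4 = 16 * s ^+ 4 * y ^+ 2 by rewrite /y; field.
  (* Squaring $y/2\le e^{y/2}$ gives the 4; with $x^4=16s^4y^2$ this yields the 64 in [c]. *)
  have ey : y ^+ 2 <= 4 * expR y.
    have := expR_ge1Dx (y / 2).
    rewrite (_ : expR y = expR (y / 2) ^+ 2).
      by nra.
    by rewrite expr2 -expRD; congr expR; field.
  rewrite xy (_ : - y = y - 2 * y); last by ring.
  rewrite expRD mulrA ler_pM2r ?expR_gt0//.
  have s4 : 0 < s ^+ 4 by rewrite exprn_even_gt0.
  rewrite mulrAC; apply: le_trans (_ : 16 * s ^+ 4 * (4 * expR y) <= _).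
    by rewrite mulrAC ler_pM2l// mulr_gt0.
  by rewrite le_eqVlt; apply/orP; left; apply/eqP; ring.
rewrite ge0_integralZl//=; last first.
  - by move=> x _; rewrite lee_fin normal_pdf_ge0.
  - by apply/measurable_EFinP; exact: measurable_normal_pdf.
by rewrite integral_normal_pdf mule1 ltry.
Qed.

End normal_law.

(** * Symmetry and fourth moment of the standard complex Gaussian *)

Section complex_gaussian.
Context {R : realType}.
Local Notation N2 := (@normal_prob R 0 (Num.sqrt 2^-1)).

Let s0 : Num.sqrt 2^-1 != 0 :> R.
Proof. by rewrite gt_eqF// sqrtr_gt0 invr_gt0. Qed.

Local Notation RR := (measurableTypeR R * measurableTypeR R)%type.

Definition pair_opp (z : RR) : RR := (- z.1, - z.2).

Lemma measurable_pair_opp : measurable_fun setT pair_opp.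
Proof.
apply/measurable_fun_pairP; split.
  exact: (measurableT_comp (@oppr_measurable R setT) measurable_fst).
exact: (measurableT_comp (@oppr_measurable R setT) measurable_snd).
Qed.

Lemma product_normal_prob_opp (B : set (R * R)) : measurable B ->
  (N2 \x N2)%E (pair_opp @^-1` B) = (N2 \x N2)%E B.
Proof.
move=> mB; pose m' := image_measure (N2 \x N2)%E measurable_pair_opp.
change (m' B = (N2 \x N2)%E B); apply/esym.
apply: (@product_measure_unique _ _ _ _ R N2 N2 m' _ B mB) => C D mC mD.
rewrite /= /pushforward.
have -> : pair_opp @^-1` (C `*` D) = (-%R @^-1` C) `*` (-%R @^-1` D) by [].
have mopp (E : set R) : measurable E -> measurable (-%R @^-1` E).
  move=> mE; rewrite -[X in measurable X]setTI.
  exact: (@oppr_measurable R setT measurableT E mE).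
rewrite product_measure1E; [|exact: mopp|exact: mopp].
congr (_ * _)%E.
  exact: (@normal_prob_oppr R (Num.sqrt 2^-1) C s0 mC).
exact: (@normal_prob_oppr R (Num.sqrt 2^-1) D s0 mD).
Qed.

Variables (d : measure_display) (Omega : measurableType d) (P : probability Omega R).

Lemma standard_complex_gaussian_opp (g : Omega -> R[i]%C) (B : set (R * R)) :
  standard_complex_gaussian P g -> measurable B ->
  P ((@ReIm R \o g) @^-1` (pair_opp @^-1` B)) = P ((@ReIm R \o g) @^-1` B).
Proof.
move=> [_ gP] mB; rewrite !gP//; first exact: product_normal_prob_opp.
by rewrite -[X in measurable X]setTI; exact: (measurable_pair_opp measurableT mB).
Qed.

Lemma standard_complex_gaussian_fourth_moment : exists2 m : R, 0 < m &
  forall g : Omega -> R[i]%C, standard_complex_gaussian P g ->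
  (\int[P]_w (normc (g w) ^+ 4)%:E <= m%:E)%E.
Proof.
pose m1 := (\int[N2]_x (x ^+ 4)%:E)%E.
have m1fin : m1 \is a fin_num.
  rewrite ge0_fin_numE ?normal_prob_fourth_moment//.
  by apply: integral_ge0 => x _; rewrite lee_fin exprn_even_ge0.
have m10 : (0 <= m1)%E.
  by apply: integral_ge0 => x _; rewrite lee_fin exprn_even_ge0.
(* From $|g|^4\le2(\mathrm{Re}\,g)^4+2(\mathrm{Im}\,g)^4$ the moment is at most [4 * m1]; the added
   1 ensures strict positivity. *)
exists (4 * fine m1 + 1); first by rewrite ltr_wpDl// mulr_ge0// fine_ge0.
move=> g [mg0 gP].
have mg : measurable_fun setT ((@ReIm R \o g) : Omega -> RR) by [].
pose f (z : RR) : R := 2 * z.1 ^+ 4 + 2 * z.2 ^+ 4.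
have mf : measurable_fun setT f.
  apply: measurable_funD; apply: measurable_funM => //; apply: measurable_funX.
    exact: measurable_fst.
  exact: measurable_snd.
have f0 z : 0 <= f z by rewrite addr_ge0// mulr_ge0// exprn_even_ge0.
apply: (@le_trans _ _ (\int[P]_w (f (((@ReIm R \o g) : Omega -> RR) w))%:E)%E).
  apply: ge0_le_integral_sup => w _; first by rewrite lee_fin exprn_even_ge0.
  rewrite lee_fin (_ : normc (g w) ^+ 4 = (normc (g w) ^+ 2) ^+ 2).
    rewrite sqr_normc_ReIm /f /=.
    by have := sqr_ge0 (cRe (g w) ^+ 2 - cIm (g w) ^+ 2); nra.
  by rewrite -exprM.
have -> : (\int[P]_w (f (((@ReIm R \o g) : Omega -> RR) w))%:E =
   \int[image_measure P mg]_z (f z)%:E)%E.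
  rewrite /image_measure ge0_integral_pushforward//=.
    exact/measurable_EFinP.
  by move=> z _; rewrite lee_fin.
have -> : (\int[image_measure P mg]_z (f z)%:E = \int[N2 \x N2]_z (f z)%:E)%E.
  by apply: eq_measure_integral => B mB _; exact: gP.
rewrite fubini_tonelli1; [|exact/measurable_EFinP|by move=> z; rewrite lee_fin].
have intc (c : \bar R) : (\int[N2]_y c = c)%E.
  rewrite integral_cst// -[RHS]mule1; congr (_ * _)%E; exact: probability_setT.
have mX4 : measurable_fun setT (fun x : R => x ^+ 4) by exact: measurable_funX.
have E (x : R) : (\int[N2]_y (f (x, y))%:E = (2 * x ^+ 4)%:E + 2%:E * m1)%E.
  under eq_integral do rewrite /f /= EFinD.
  rewrite ge0_integralD//=.
  - rewrite intc; congr (_ + _)%E.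
    under eq_integral do rewrite EFinM.
    rewrite ge0_integralZl//=; first exact/measurable_EFinP.
    by move=> y _; rewrite lee_fin exprn_even_ge0.
  - by move=> y _; rewrite lee_fin mulr_ge0// exprn_even_ge0.
  - by move=> y _; rewrite lee_fin mulr_ge0// exprn_even_ge0.
  - by apply/measurable_EFinP; exact: measurable_funM.
rewrite /fubini_F; under eq_integral do rewrite E.
rewrite ge0_integralD//=.
- rewrite intc.
  under eq_integral do rewrite EFinM.
  rewrite ge0_integralZl//=; last 2 first.
  + exact/measurable_EFinP.
  + by move=> y _; rewrite lee_fin exprn_even_ge0.
  rewrite -/m1 -(fineK m1fin) -!EFinM -EFinD lee_fin; lra.
- by move=> y _; rewrite lee_fin mulr_ge0// exprn_even_ge0.
- by apply/measurable_EFinP; exact: measurable_funM.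
- by move=> y _; rewrite mule_ge0.
Qed.

End complex_gaussian.

(** * Sign symmetry and moments of the Gaussian series *)

Section finite_cylinders.
Context {R : realType}.
Local Notation RR := (measurableTypeR R * measurableTypeR R)%type.

Definition finite_cylinder (J : seq int) (B : int -> set RR) : set (torus_dist R) :=
  [set u | forall n, n \in J -> B n (cRe (u n), cIm (u n))].

(** Unlike the one-coefficient cylinders, these are closed under intersection. They generate the
    same sigma-algebra, so finite measures are determined by them, and independence computes the law
    on them. *)
Definition finite_cylinders : set (set (torus_dist R)) :=
  [set E | exists2 J : seq int, uniq J & exists2 B : int -> set RR,
     (forall n, measurable (B n)) & E = finite_cylinder J B].

Lemma measurable_finite_cylinder (J : seq int) (B : int -> set RR) :
  (forall n, measurable (B n)) -> measurable (finite_cylinder J B).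
Proof.
move=> mB; rewrite (_ : finite_cylinder J B = \bigcap_(n in [set` J])
  [set u : torus_dist R | B n (cRe (u n), cIm (u n))]).
  apply: fin_bigcap_measurable => [|n _]; first exact: finite_seq.
  have H : measurable (B n : set (R * R)) := mB n.
  exact: (@measurable_coef R n (B n) H).
by apply/seteqP; split => u uB n /= nJ; exact: uB.
Qed.

Lemma measurable_torus_distE :
  @measurable _ (torus_dist R) = <<s finite_cylinders >>.
Proof.
apply/seteqP; split; last first.
  apply: smallest_sub; first exact: sigma_algebra_measurable.
  by move=> _ [J _ [B mB ->]]; exact: measurable_finite_cylinder.
apply: smallest_sub; first exact: smallest_sigma_algebra.
move=> _ [n [B mB ->]]; apply: sub_sigma_algebra.
exists [:: n] => //; exists (fun=> B) => //.
apply/seteqP; split => u /= uB; last by apply: uB; rewrite inE.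
by move=> m; rewrite inE => /eqP ->.
Qed.

Lemma finite_cylinders_setI : setI_closed finite_cylinders.
Proof.
move=> _ _ [J uJ [B mB ->]] [J' uJ' [B' mB' ->]].
exists (undup (J ++ J')); first exact: undup_uniq.
exists (fun n =>
  (if n \in J then B n else setT) `&` (if n \in J' then B' n else setT)).
  by move=> n; apply: measurableI; case: ifP.
apply/seteqP; split => u /=.
  by move=> [uB uB'] n _; split; case: ifPn => // nJ; [exact: uB|exact: uB'].
move=> uBB; split=> n nJ; have := uBB n; rewrite mem_undup mem_cat nJ ?orbT/=.
  by move=> /(_ isT)[].
by move=> /(_ isT)[].
Qed.

Lemma torus_measure_unique (m1 m2 : {measure set (torus_dist R) -> \bar R}) :
  (m1 setT < +oo)%E ->
  (forall E, finite_cylinders E -> m1 E = m2 E) ->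
  forall A, measurable A -> m1 A = m2 A.
Proof.
move=> m1oo m12; apply: (measure_unique finite_cylinders (fun=> setT)).
- exact: measurable_torus_distE.
- exact: finite_cylinders_setI.
- move=> _; exists [::] => //; exists (fun=> setT) => //.
  by apply/seteqP; split.
- by rewrite bigcup_const.
- exact: m12.
- by move=> _; exact: m1oo.
Qed.

Definition coef_flip (m : int) (u : torus_dist R) : torus_dist R :=
  fun n => if n == m then - u n else u n.

Lemma coef_flip_cylinder m J (B : int -> set RR) :
  coef_flip m @^-1` finite_cylinder J B =
  finite_cylinder J (fun n => if n == m then pair_opp @^-1` B n else B n).
Proof.
by apply/seteqP; split => u uB n nJ; have := uB n nJ;
  rewrite /coef_flip; case: eqP => //; rewrite /= !raddfN.
Qed.

Lemma measurable_pair_opp_preimage (B : set RR) :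
  measurable B -> measurable (@pair_opp R @^-1` B).
Proof.
move=> mB; rewrite -[X in measurable X]setTI.
exact: (measurable_pair_opp measurableT mB).
Qed.

Lemma measurable_coef_flip m : measurable_fun setT (coef_flip m).
Proof.
apply: (measurability finite_cylinders); first exact: measurable_torus_distE.
move=> _ [_ [J _ [B mB ->]] <-]; rewrite setTI coef_flip_cylinder.
apply: measurable_finite_cylinder => n; case: eqP => // _.
exact: measurable_pair_opp_preimage.
Qed.

End finite_cylinders.

Section gaussian_series_law.
Context {R : realType} (alpha : R).
Context (d : measure_display) (Omega : measurableType d) (P : probability Omega R).
Context (g : int -> Omega -> R[i]%C) (mu : {measure set (torus_dist R) -> \bar R}).
Hypothesis hgauss : forall n, standard_complex_gaussian P (g n).
Hypothesis hindep : mutually_independent P g.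
Hypothesis hmu : is_law_of P (random_series alpha g) mu.
Local Notation RR := (measurableTypeR R * measurableTypeR R)%type.

(** The variance $\mathbb E|u_n|^2$ of the coefficient [n] under [mu]. *)
Definition mode_weight (n : int) : R := (1 + symbol alpha n)^-1.

Lemma mode_weight_gt0 n : 0 < mode_weight n.
Proof. by rewrite invr_gt0 ltr_pwDl// powR_ge0. Qed.

Lemma mode_weight_sqrt n : (Num.sqrt (1 + symbol alpha n))^-1 ^+ 2 = mode_weight n.
Proof. by rewrite exprVn sqr_sqrtr// addr_ge0// powR_ge0. Qed.

Lemma law_setT : mu setT = 1%E.
Proof. by rewrite hmu.2// /pushforward preimage_setT probability_setT. Qed.

Definition pair_scale (c : R) (z : RR) : RR := (z.1 * c, z.2 * c).

Lemma measurable_pair_scale_preimage c (B : set RR) :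
  measurable B -> measurable (pair_scale c @^-1` B).
Proof.
move=> mB; rewrite -[X in measurable X]setTI.
suff mc : measurable_fun setT (pair_scale c) by exact: (mc measurableT B mB).
apply/measurable_fun_pairP; split.
  exact: (measurable_funM measurable_fst (measurable_cst c)).
exact: (measurable_funM measurable_snd (measurable_cst c)).
Qed.

Lemma random_seriesE n w : let c := (Num.sqrt (1 + symbol alpha n))^-1 in
  random_series alpha g w n = ((cRe (g n w) * c) +i* (cIm (g n w) * c))%C.
Proof.
rewrite /random_series -fmorphV/=; case: (g n w) => a b /=.
by apply/eqP; rewrite eq_complex/= !mulr0 subr0 add0r !eqxx.
Qed.

Lemma law_finite_cylinder J (B : int -> set RR) : uniq J ->
  (forall n, measurable (B n)) ->
  mu (finite_cylinder J B) = (\prod_(n <- J) P ((@ReIm R \o g n) @^-1`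
    (pair_scale (Num.sqrt (1 + symbol alpha n))^-1 @^-1` B n)))%E.
Proof.
move=> uJ mB; rewrite hmu.2; last exact: measurable_finite_cylinder.
rewrite -hindep//; last by move=> n; exact: measurable_pair_scale_preimage.
congr (P _); apply/seteqP; split => w /= wB n nJ.
  by have := wB n nJ; rewrite random_seriesE.
by rewrite random_seriesE; exact: wB.
Qed.

(** On finite cylinders the law is a product, in which only the factor of index [m] changes, and
    that factor is symmetric. *)
Lemma law_coef_flip m (A : set (torus_dist R)) : measurable A ->
  mu (coef_flip m @^-1` A) = mu A.
Proof.
move=> mA; pose m' := image_measure mu (measurable_coef_flip m).
change (m' A = mu A).
apply: torus_measure_unique mA.
  by rewrite /= /pushforward preimage_setT law_setT ltry.
move=> _ [J uJ [B mB ->]]; rewrite /= /pushforward coef_flip_cylinder.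
rewrite !law_finite_cylinder//; last first.
  by move=> n; case: eqP => // _; exact: measurable_pair_opp_preimage.
apply: eq_bigr => n _; case: eqP => // _.
rewrite -[RHS](standard_complex_gaussian_opp (hgauss n)); last first.
  exact: measurable_pair_scale_preimage.
congr (P _); apply/seteqP; split => w /=;
  by rewrite /pair_scale /pair_opp /= !mulNr.
Qed.

Lemma law_fourth_moment : exists2 m4 : R, 0 < m4 & forall n,
  (\int[mu]_u (normc (u n) ^+ 4)%:E <= (m4 * mode_weight n ^+ 2)%:E)%E.
Proof.
have [m4 m40 m4P] := standard_complex_gaussian_fourth_moment P.
exists m4 => // n.
have mX := hmu.1.
have mf : measurable_fun [set: torus_dist R] (fun u : torus_dist R => normc (u n) ^+ 4).
  rewrite (_ : (fun _ => _) = fun u : torus_dist R =>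
    (cRe (u n) ^+ 2 + cIm (u n) ^+ 2) ^+ 2); last first.
    by apply/funext => u; rewrite pow4_normc_ReIm.
  apply/measurable_funX/measurable_funD; apply: measurable_funX.
    exact: measurable_coef_Re.
  exact: measurable_coef_Im.
have -> : (\int[mu]_u (normc (u n) ^+ 4)%:E =
    \int[P]_w (normc (random_series alpha g w n) ^+ 4)%:E)%E.
  transitivity (\int[image_measure P mX]_u (normc (u n) ^+ 4)%:E)%E.
    by apply: eq_measure_integral => A mA _; exact: hmu.2.
  rewrite /image_measure ge0_integral_pushforward//=; first exact/measurable_EFinP.
  by move=> u _; rewrite lee_fin exprn_even_ge0.
pose c := (Num.sqrt (1 + symbol alpha n))^-1.
under eq_integral.
  move=> w _; rewrite random_seriesE.
  rewrite (_ : normc _ ^+ 4 = mode_weight n ^+ 2 * normc (g n w) ^+ 4); last first.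
    by rewrite -mode_weight_sqrt !pow4_normc_ReIm /= -/c; ring.
  rewrite EFinM; over.
rewrite ge0_integralZl//=; last 3 first.
- have mg : measurable_fun setT ((@ReIm R \o g n) : Omega -> RR) by have [] := hgauss n.
  apply/measurable_EFinP; rewrite (_ : (fun _ => _) = fun w =>
    ((ReIm (g n w)).1 ^+ 2 + (ReIm (g n w)).2 ^+ 2) ^+ 2); last first.
    by apply/funext => w; rewrite pow4_normc_ReIm.
  apply/measurable_funX/measurable_funD; apply: measurable_funX.
    exact: (measurableT_comp measurable_fst mg).
  exact: (measurableT_comp measurable_snd mg).
- by move=> w _; rewrite lee_fin exprn_even_ge0.
- by rewrite lee_fin sqr_ge0.
rewrite [m4 * _]mulrC [leRHS]EFinM.
apply: lee_wpmul2l; first by rewrite lee_fin sqr_ge0.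
exact: m4P.
Qed.

End gaussian_series_law.

(** * Measurability of complex-valued functions *)

Section complex_measurability.
Context {R : realType} d (T : measurableType d).
Implicit Types F G : T -> R[i]%C.

Definition cmeas F : Prop :=
  measurable_fun setT (fun x => cRe (F x)) /\ measurable_fun setT (fun x => cIm (F x)).

Lemma cmeas_cst (c : R[i]%C) : cmeas (fun=> c).
Proof. by split; exact: measurable_cst. Qed.

Lemma cmeasD F G : cmeas F -> cmeas G -> cmeas (fun x => F x + G x).
Proof.
move=> [F1 F2] [G1 G2]; split.
  rewrite (_ : (fun x => _) = fun x => cRe (F x) + cRe (G x)).
    exact: measurable_funD.
  by apply/funext => x; rewrite raddfD.
rewrite (_ : (fun x => _) = fun x => cIm (F x) + cIm (G x)).
  exact: measurable_funD.
by apply/funext => x; rewrite raddfD.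
Qed.

Lemma cmeasM F G : cmeas F -> cmeas G -> cmeas (fun x => F x * G x).
Proof.
move=> [F1 F2] [G1 G2]; split.
  rewrite (_ : (fun x => _) = fun x => cRe (F x) * cRe (G x) - cIm (F x) * cIm (G x)).
    by apply: measurable_funB; exact: measurable_funM.
  by apply/funext => x; case: (F x) (G x) => [a b] [a' b'].
rewrite (_ : (fun x => _) = fun x => cRe (F x) * cIm (G x) + cIm (F x) * cRe (G x)).
  by apply: measurable_funD; exact: measurable_funM.
by apply/funext => x; case: (F x) (G x) => [a b] [a' b'].
Qed.

Lemma cmeas_sum (I : Type) (J : seq I) (F : I -> T -> R[i]%C) :
  (forall n, cmeas (F n)) -> cmeas (fun x => \sum_(n <- J) F n x).
Proof.
move=> mF; elim: J => [|n J IH].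
  under eq_fun do rewrite big_nil; exact: cmeas_cst.
by under eq_fun do rewrite big_cons; exact: cmeasD.
Qed.

Lemma measurable_normc_pow4 F : cmeas F ->
  measurable_fun setT (fun x => normc (F x) ^+ 4).
Proof.
move=> [F1 F2]; under eq_fun do rewrite pow4_normc_ReIm.
by apply/measurable_funX/measurable_funD; exact: measurable_funX.
Qed.

End complex_measurability.

Lemma cmeas_coef (R : realType) (n : int) : cmeas (fun u : torus_dist R => u n).
Proof. by split; [exact: measurable_coef_Re|exact: measurable_coef_Im]. Qed.

(** * Uniform summability of the variances *)

Section mode_weight_sum.
Context {R : realType}.

(* Used with [a = k^(1/5)] and [b = (k+1)^(1/5)], where the left-hand side is
   [k^(-6/5)]. *)
Lemma pow_6_5_telescope (a b k : R) : 0 < a -> 0 < b -> 1 <= k ->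
  a ^+ 5 = k -> b ^+ 5 = k + 1 -> (a ^+ 6)^-1 <= 10 * (a^-1 - b^-1).
Proof.
move=> a0 b0 k1 ak bk.
have an : a \in Num.nneg by rewrite nnegrE ltW.
have bn : b \in Num.nneg by rewrite nnegrE ltW.
have ab : a <= b by rewrite -(@ler_pXn2r _ 5)// ak bk; lra.
have b4 : 0 < b ^+ 4 by rewrite exprn_gt0.
have key : 1 <= 5 * b ^+ 4 * (b - a).
  have e1 : 1 = (b - a) * (b ^+ 4 + b ^+ 3 * a + b ^+ 2 * a ^+ 2 + b * a ^+ 3 + a ^+ 4).
    by transitivity (b ^+ 5 - a ^+ 5); [rewrite ak bk; ring|ring].
  rewrite [leLHS]e1 [leLHS]mulrC; apply: ler_wpM2r; first by rewrite subr_ge0.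
  have le1 : b ^+ 3 * a <= b ^+ 4.
    by rewrite [leRHS]exprSr; apply: ler_wpM2l => //; rewrite exprn_ge0// ltW.
  have le2 : b ^+ 2 * a ^+ 2 <= b ^+ 4.
    rewrite (_ : b ^+ 4 = b ^+ 2 * b ^+ 2); last by ring.
    by apply: ler_wpM2l; [rewrite exprn_ge0// ltW|rewrite ler_pXn2r].
  have le3 : b * a ^+ 3 <= b ^+ 4.
    rewrite [leRHS]exprS; apply: ler_wpM2l; first exact: ltW.
    by rewrite ler_pXn2r.
  have le4 : a ^+ 4 <= b ^+ 4 by rewrite ler_pXn2r.
  by lra.
(* Over the common denominator $ab^5$ it remains to compare numerators: $b^5/a^5=(k+1)/k\le2$, while
   [key] bounds the other from below by 2. *)
have -> : 10 * (a^-1 - b^-1) = 2 * (5 * b ^+ 4 * (b - a)) / (a * b ^+ 5).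
  by field; rewrite !gt_eqF.
have -> : (a ^+ 6)^-1 = b ^+ 5 / a ^+ 5 / (a * b ^+ 5).
  by field; rewrite !gt_eqF.
apply: ler_wpM2r; first by rewrite invr_ge0 mulr_ge0 ?exprn_ge0 ?ltW.
rewrite ler_pdivrMr ?exprn_gt0// bk ak; nra.
Qed.

Lemma mode_weight_sum_le (alpha : R) (N : nat) : 6 / 5 < alpha ->
  \sum_(k < (2 * N).+1) mode_weight alpha (k%:Z - N%:Z) <= 21.
Proof.
move=> halpha; pose r (k : nat) : R := (k%:R `^ (1 / 5))^-1.
have r0 k : 0 <= r k by rewrite invr_ge0 powR_ge0.
have wr (n : int) (k : nat) : `|n|%N = k.+1 ->
    mode_weight alpha n <= 10 * (r k.+1 - r k.+2).
  move=> nk.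
  have pos m : 0 < m.+1%:R `^ (1 / 5) :> R by rewrite powR_gt0// ltr0n.
  have p5 m : (m.+1%:R `^ (1 / 5)) ^+ 5 = m.+1%:R :> R.
    rewrite -powR_mulrn ?powR_ge0// -powRrM (_ : 1 / 5 * 5%:R = 1); last by field.
    by rewrite powRr1.
  apply: le_trans (pow_6_5_telescope (pos k) (pos k.+1) _ (p5 k) _); last 2 first.
  - by rewrite ler1n.
  - by rewrite p5 -[k.+2]addn1 natrD.
  rewrite lef_pV2 ?posrE ?exprn_gt0//; last first.
    by rewrite ltr_pwDl// powR_ge0.
  rewrite -powR_mulrn ?powR_ge0// -powRrM (_ : 1 / 5 * 6%:R = 6 / 5 :> R); last by field.
  rewrite /symbol.
  have -> : (`|n|%:~R : R) = k.+1%:R by rewrite -nk natr_absz.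
  apply: (@le_trans _ _ (k.+1%:R `^ alpha)); last by rewrite lerDr.
  by apply: ler_powR; rewrite ?ler1n// ltW.
(* The telescoping form makes the induction close: the modes $\pm(N+1)$ add at most 10 times an
   increment each, and the mode 0 contributes at most 1. *)
suff H : \sum_(k < (2 * N).+1) mode_weight alpha (k%:Z - N%:Z) <= 1 + 20 * (1 - r N.+1).
  by apply: (le_trans H); have := r0 N.+1; lra.
elim: N => [|N IH].
  have -> : r 1 = 1 by rewrite /r powR1 invr1.
  rewrite muln0 big_ord_recl big_ord0 addr0 (subrr 1) mulr0 addr0.
  rewrite /mode_weight addr0 invf_le1; first by rewrite lerDl powR_ge0.
  by rewrite ltr_pwDl// powR_ge0.
rewrite (_ : (2 * N.+1).+1 = (2 * N).+3)%N; last by rewrite mulnS.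
rewrite big_ord_recl big_ord_recr /=.
have -> : \sum_(i < (2 * N).+1) mode_weight alpha ((bump 0 i)%:Z - N.+1%:Z) =
          \sum_(k < (2 * N).+1) mode_weight alpha (k%:Z - N%:Z).
  by apply: eq_bigr => i _; congr mode_weight; rewrite /bump /=; lia.
have w1 : mode_weight alpha (0%:Z - N.+1%:Z) <= 10 * (r N.+1 - r N.+2).
  by apply: wr; lia.
have w2 : mode_weight alpha ((bump 0 (2 * N).+1)%:Z - N.+1%:Z) <= 10 * (r N.+1 - r N.+2).
  by apply: wr; rewrite /bump /=; lia.
lra.
Qed.

End mode_weight_sum.

(** The terms odd in [T] cancel. With $X=|S|^2$, $Y=|T|^2$, Cauchy-Schwarz leaves at most
    $2X^2+2Y^2+12XY$, and a weighted mean inequality with parameter [l] splits $XY$. *)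
Lemma normc_pow4_parallelogram (R : realType) (S T : R[i]%C) (l : R) : 0 < l ->
  normc (T + S) ^+ 4 + normc (- T + S) ^+ 4 <=
  2 * (1 + 3 * l) * normc S ^+ 4 + 2 * (1 + 3 / l) * normc T ^+ 4.
Proof.
move=> l0; rewrite !pow4_normc_ReIm; case: S T => [a b] [p q] /=.
set X := a ^+ 2 + b ^+ 2; set Y := p ^+ 2 + q ^+ 2.
pose r := a * p + b * q.
have -> : (p + a) ^+ 2 + (q + b) ^+ 2 = X + Y + 2 * r by rewrite /X /Y /r; ring.
have -> : (- p + a) ^+ 2 + (- q + b) ^+ 2 = X + Y - 2 * r by rewrite /X /Y /r; ring.
have rXY : r ^+ 2 <= X * Y.
  have -> : X * Y = r ^+ 2 + (a * q - b * p) ^+ 2 by rewrite /X /Y /r; ring.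
  by rewrite lerDl sqr_ge0.
have XY : 2 * (X * Y) <= l * X ^+ 2 + l^-1 * Y ^+ 2.
  rewrite -subr_ge0 (_ : _ - _ = l^-1 * (l * X - Y) ^+ 2); last first.
    by field; rewrite gt_eqF.
  by rewrite mulr_ge0 ?sqr_ge0// invr_ge0 ltW.
have -> : 2 * (1 + 3 * l) * X ^+ 2 + 2 * (1 + 3 / l) * Y ^+ 2 =
   2 * X ^+ 2 + 2 * Y ^+ 2 + 6 * (l * X ^+ 2 + l^-1 * Y ^+ 2) by ring.
have -> : (X + Y + 2 * r) ^+ 2 + (X + Y - 2 * r) ^+ 2 =
  2 * X ^+ 2 + 2 * Y ^+ 2 + 4 * (X * Y) + 8 * r ^+ 2 by ring.
lra.
Qed.

Lemma normc_cis (R : realType) (x : R) : normc (cis x) = 1.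
Proof. by rewrite /cis /= cos2Dsin2 sqrtr1. Qed.

(** * Fourth moments of random trigonometric sums *)

Section fourth_moment.
Context {R : realType} (mu : {measure set (torus_dist R) -> \bar R}).
Context (a : int -> R) (m4 : R).
Hypothesis muT : mu setT = 1%E.
Hypothesis mu_flip : forall m (A : set (torus_dist R)), measurable A ->
  mu (coef_flip m @^-1` A) = mu A.
Hypothesis a0 : forall n, 0 < a n.
Hypothesis m40 : 0 < m4.
Hypothesis mu_m4 : forall n,
  (\int[mu]_u (normc (u n) ^+ 4)%:E <= (m4 * a n ^+ 2)%:E)%E.

Lemma integral_coef_flip m (f : torus_dist R -> \bar R) :
  measurable_fun setT f -> (forall u, 0 <= f u)%E ->
  (\int[mu]_u f (coef_flip m u) = \int[mu]_u f u)%E.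
Proof.
move=> mf f0; transitivity (\int[image_measure mu (measurable_coef_flip m)]_u f u)%E.
  by rewrite /image_measure (ge0_integral_pushforward (measurable_coef_flip m)).
by apply: eq_measure_integral => A mA _; exact: mu_flip.
Qed.

(** Modes are added one at a time. Invariance under the flip of the new coefficient allows averaging
    the integrand over both signs, after which the parallelogram bound applies. The 1 added to the
    sum of variances keeps the parameter [l] well defined. *)
Lemma fourth_moment_sum (J : seq int) (c : int -> R[i]%C) :
  (forall n, normc (c n) = 1) -> uniq J ->
  (\int[mu]_u (normc (\sum_(n <- J) u n * c n)%R ^+ 4)%:E <=
   (9 * m4 * (1 + \sum_(n <- J) a n) ^+ 2)%:E)%E.
Proof.
move=> c1; elim: J => [_|m J IH /= /andP[mJ uJ]].
  under eq_integral do rewrite big_nil ComplexField.Normc.normc0 expr0n /=.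
  by rewrite integral0 lee_fin mulr_ge0 ?sqr_ge0// mulr_ge0// ltW.
have {}IH := IH uJ.
pose F (u : torus_dist R) := \sum_(n <- J) u n * c n.
have cF : cmeas F.
  by apply: cmeas_sum => n; apply: cmeasM; [exact: cmeas_coef|exact: cmeas_cst].
have cm : cmeas (fun u : torus_dist R => u m * c m).
  by apply: cmeasM; [exact: cmeas_coef|exact: cmeas_cst].
pose f (u : torus_dist R) := (normc (u m * c m + F u) ^+ 4)%:E.
have mf : measurable_fun setT f.
  by apply/measurable_EFinP; apply: measurable_normc_pow4; exact: cmeasD.
have f0 u : (0 <= f u)%E by rewrite lee_fin exprn_even_ge0.
have mF : measurable_fun setT (fun u => (normc (F u) ^+ 4)%:E).
  by apply/measurable_EFinP; exact: measurable_normc_pow4.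
have mm : measurable_fun setT (fun u : torus_dist R => (normc (u m) ^+ 4)%:E).
  apply/measurable_EFinP; apply: measurable_normc_pow4; exact: cmeas_coef.
under eq_integral do rewrite big_cons.
rewrite big_cons -/(F _).
pose A1 := 1 + \sum_(n <- J) a n.
have A10 : 0 < A1 by rewrite ltr_pwDl// sumr_ge0// => n _; exact: ltW.
have am := a0 m.
(* This [l] balances the two terms of [normc_pow4_parallelogram] so that the
   bound [9 * m4 * A1 ^+ 2] propagates. *)
pose l := a m / (3 * A1).
have l0 : 0 < l by rewrite divr_gt0// mulr_gt0.
have E2 : (\int[mu]_u f u + \int[mu]_u f u =
   \int[mu]_u (f u + f (coef_flip m u)))%E.
  rewrite ge0_integralD//=; first by rewrite integral_coef_flip.
  exact: (measurableT_comp mf (measurable_coef_flip m)).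
have flipF u : F (coef_flip m u) = F u.
  apply: eq_big_seq => n nJ; rewrite /coef_flip; case: eqP => // nm.
  by rewrite nm (negbTE mJ) in nJ.
have k1 : 0 <= 2 * (1 + 3 * l) by rewrite mulr_ge0// addr_ge0// mulr_ge0// ltW.
have k2 : 0 <= 2 * (1 + 3 / l).
  by rewrite mulr_ge0// addr_ge0// divr_ge0// ltW.
have bound : (\int[mu]_u f u + \int[mu]_u f u <=
    (2 * (1 + 3 * l) * (9 * m4 * A1 ^+ 2) + 2 * (1 + 3 / l) * (m4 * a m ^+ 2))%:E)%E.
  rewrite E2; apply: (@le_trans _ _
    (\int[mu]_u ((2 * (1 + 3 * l))%:E * (normc (F u) ^+ 4)%:E
      + (2 * (1 + 3 / l))%:E * (normc (u m) ^+ 4)%:E))%E).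
    apply: ge0_le_integral_sup => u _; first by rewrite adde_ge0.
    rewrite /f flipF -!EFinM -!EFinD lee_fin /coef_flip eqxx mulNr.
    have := normc_pow4_parallelogram (F u) (u m * c m) l0.
    by rewrite ComplexField.Normc.normcM c1 mulr1.
  have F0 u : (0 <= (normc (F u) ^+ 4)%:E)%E by rewrite lee_fin exprn_even_ge0.
  have u0 (u : torus_dist R) : (0 <= (normc (u m) ^+ 4)%:E)%E.
    by rewrite lee_fin exprn_even_ge0.
  rewrite ge0_integralD; [|exact: measurableT|by move=> *; rewrite mule_ge0
    |exact: measurable_funeM|by move=> *; rewrite mule_ge0|exact: measurable_funeM].
  rewrite !ge0_integralZl//.
  rewrite EFinD !(EFinM (2 * _)); apply: leeD.
    by apply: lee_wpmul2l; [rewrite lee_fin|exact: IH].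
  by apply: lee_wpmul2l; [rewrite lee_fin|exact: mu_m4].
have : (\int[mu]_u f u <= (9 * m4 * (A1 + a m) ^+ 2)%:E)%E.
  have fin : (\int[mu]_u f u \is a fin_num)%E.
    rewrite ge0_fin_numE; last exact: integral_ge0.
    apply: (le_lt_trans (le_trans _ bound) (ltry _)).
    by rewrite leeDl// integral_ge0.
  move: bound; rewrite -(fineK fin) -EFinD !lee_fin => bound.
  (* The bracket is at most $9(A_1+a_m)^2$, which is the bound for the enlarged set of modes. *)
  have : 2 * (1 + 3 * l) * (9 * m4 * A1 ^+ 2) + 2 * (1 + 3 / l) * (m4 * a m ^+ 2) =
    2 * (m4 * (9 * A1 ^+ 2 + 18 * (A1 * a m) + a m ^+ 2)).
    by rewrite /l; field; rewrite !gt_eqF.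
  have : 0 <= m4 * a m ^+ 2 by rewrite mulr_ge0 ?sqr_ge0// ltW.
  move=> h1 h2; move: bound; rewrite h2; nra.
by rewrite /A1 /f addrAC addrA.
Qed.

End fourth_moment.

(** * The potential is finite almost everywhere *)

Lemma le_limn_einf (R : realType) (u : (\bar R)^nat) (r : \bar R) (N0 : nat) :
  (forall N, (N0 <= N)%N -> (r <= u N)%E) -> (r <= limn_einf u)%E.
Proof.
move=> ru; rewrite limn_einf_lim; apply: lime_ge.
  by apply: ereal_nondecreasing_is_cvgn; exact: nondecreasing_einfs.
exists N0 => // n /= n0; apply: le_ereal_inf_tmp => _ [m /= nm <-].
by apply: ru; exact: leq_trans nm.
Qed.

Section potential_bound.
Context {R : realType}.
Notation leb := (@lebesgue_measure R).
Local Notation period := (@period R).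
Implicit Types (u : int -> R[i]%C) (f : R -> R[i]%C).

Definition partial_L4 u (N : nat) : \bar R :=
  (\int[leb]_(x in period) (normc (partial_sum u N x) ^+ 4)%:E)%E.

Lemma measurable_period : measurable period.
Proof. exact: measurable_itv. Qed.

Lemma measurable_trig_mul (r : R) :
  measurable_fun setT (fun x : R => cos (r * x)) /\
  measurable_fun setT (fun x : R => sin (r * x)).
Proof.
have mr : measurable_fun setT (fun x : R => r * x) by exact: measurable_funM.
split; apply: measurableT_comp mr; apply: continuous_measurable_fun.
  exact: continuous_cos.
exact: continuous_sin.
Qed.

Lemma cmeas_cis (r : R) : @cmeas R _ (measurableTypeR R) (fun x => cis (r * x)).
Proof. by have [? ?] := measurable_trig_mul r; split. Qed.

Lemma cmeas_partial_sum u N : @cmeas R _ (measurableTypeR R) (partial_sum u N).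
Proof.
apply: cmeas_sum => k; apply: cmeasM; first exact: cmeas_cst.
exact: cmeas_cis.
Qed.

(** Truncation makes the error linear in $|z-w|^2$, so that convergence in $L^2$ alone can control a
    fourth power. *)
Lemma sqr_truncation_le (z w : R[i]%C) (M : R) : 0 <= M ->
  (Num.min (normc z ^+ 2) M) ^+ 2 <=
  4 * normc w ^+ 4 + 4 * M * normc (z - w) ^+ 2.
Proof.
move=> M0; set m := Num.min _ _.
have m0 : 0 <= m by rewrite le_min sqr_ge0 M0.
have mM : m <= M by rewrite ge_min lexx orbT.
have mz : m <= 2 * (normc w ^+ 2 + normc (z - w) ^+ 2).
  apply: (@le_trans _ _ (normc z ^+ 2)); first by rewrite ge_min lexx.
  by have := sqr_normcD_le w (z - w); rewrite addrC subrK.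
rewrite (_ : normc w ^+ 4 = (normc w ^+ 2) ^+ 2); last by rewrite -exprM.
move: mz; set s := normc w ^+ 2; set e := normc (z - w) ^+ 2 => mz.
have s0 : 0 <= s by exact: sqr_ge0.
have e0 : 0 <= e by exact: sqr_ge0.
have me : m * e <= M * e by exact: ler_wpM2r.
have mm : m * m <= m * (2 * (s + e)) by exact: ler_wpM2l.
have := sqr_ge0 (m - 2 * s).
nra.
Qed.

(** At a fixed truncation level [M] the $L^2$ error disappears as [N] grows; monotone convergence
    then removes the truncation. The factor 4 comes from [sqr_truncation_le]. *)
Lemma L4_le_limn_einf u f : L2_sum u f ->
  (\int[leb]_(x in period) (normc (f x) ^+ 4)%:E <=
   4%:E * limn_einf (partial_L4 u))%E.
Proof.
move=> [[mfR mfI] fcvg].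
pose D : set (measurableTypeR R) := period.
have mD : measurable D := measurable_period.
have {}mfR : measurable_fun D (fun x => cRe (f x)) by exact: mfR.
have {}mfI : measurable_fun D (fun x => cIm (f x)) by exact: mfI.
have msq (h : R -> R[i]%C) : measurable_fun D (fun x => cRe (h x)) ->
    measurable_fun D (fun x => cIm (h x)) ->
    measurable_fun D (fun x => normc (h x) ^+ 2).
  move=> h1 h2; rewrite (_ : (fun x => _) = fun x => cRe (h x) ^+ 2 + cIm (h x) ^+ 2).
    by apply: measurable_funD; exact: measurable_funX.
  by apply/funext => x; rewrite sqr_normc_ReIm.
pose S N := partial_sum u N.
have mSR N : measurable_fun D (fun x => cRe (S N x)).
  by apply: measurable_funTS; have [] := cmeas_partial_sum u N.
have mSI N : measurable_fun D (fun x => cIm (S N x)).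
  by apply: measurable_funTS; have [] := cmeas_partial_sum u N.
have mfS N : measurable_fun D (fun x => normc (f x - S N x) ^+ 2).
  apply: msq.
    rewrite (_ : (fun x => _) = fun x => cRe (f x) - cRe (S N x)).
      exact: measurable_funB.
    by apply/funext => x; rewrite raddfB.
  rewrite (_ : (fun x => _) = fun x => cIm (f x) - cIm (S N x)).
    exact: measurable_funB.
  by apply/funext => x; rewrite raddfB.
have mS4 N : measurable_fun D (fun x => normc (S N x) ^+ 4).
  rewrite (_ : (fun x => _) = fun x => (normc (S N x) ^+ 2) ^+ 2).
    by apply: measurable_funX; exact: msq.
  by apply/funext => x; rewrite -exprM.
pose m (M : nat) x : R := (Num.min (normc (f x) ^+ 2) M%:R) ^+ 2.
have m0 M x : (0 <= (m M x)%:E)%E by rewrite lee_fin sqr_ge0.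
have mm M : measurable_fun D (m M).
  by apply: measurable_funX; apply: measurable_minr => //; exact: msq.
have W0 : (0 <= limn_einf (partial_L4 u))%E.
  apply: (@le_limn_einf _ _ _ 0%N) => N _; apply: integral_ge0 => x _.
  by rewrite lee_fin exprn_even_ge0.
have trunc M : (\int[leb]_(x in D) (m M x)%:E <= 4%:E * limn_einf (partial_L4 u))%E.
  have bound N : (\int[leb]_(x in D) (m M x)%:E <= 4%:E * partial_L4 u N +
      (4 * M%:R)%:E * \int[leb]_(x in D) (normc (f x - S N x) ^+ 2)%:E)%E.
    apply: (@le_trans _ _ (\int[leb]_(x in D) (4%:E * (normc (S N x) ^+ 4)%:E +
      (4 * M%:R)%:E * (normc (f x - S N x) ^+ 2)%:E))%E).
      apply: ge0_le_integral_sup => x _; first exact: m0.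
      by rewrite -!EFinM -EFinD lee_fin; exact: sqr_truncation_le.
    have S40 x : (0 <= (normc (S N x) ^+ 4)%:E)%E by rewrite lee_fin exprn_even_ge0.
    have fS0 x : (0 <= (normc (f x - S N x) ^+ 2)%:E)%E by rewrite lee_fin sqr_ge0.
    have mS4E : measurable_fun D (fun x => (normc (S N x) ^+ 4)%:E).
      by apply/measurable_EFinP; exact: mS4.
    have mfSE : measurable_fun D (fun x => (normc (f x - S N x) ^+ 2)%:E).
      by apply/measurable_EFinP; exact: mfS.
    have M0 : (0 <= (4 * M%:R : R)%:E)%E by rewrite lee_fin mulr_ge0.
    rewrite ge0_integralD; [|exact: mD|by move=> *; rewrite mule_ge0
      |exact: measurable_funeM|by move=> *; rewrite mule_ge0|exact: measurable_funeM].
    by rewrite !ge0_integralZl.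
  apply/lee_addgt0Pr => e e0.
  have d0 : 0 < e / (4 * M%:R + 1) by rewrite divr_gt0// ltr_wpDl// mulr_ge0.
  have [N0 _ N0P] : \forall N \near \oo,
      (\int[leb]_(x in D) (normc (f x - S N x) ^+ 2)%:E < (e / (4 * M%:R + 1))%:E)%E.
    apply: (fcvg [set y | (y < (e / (4 * M%:R + 1))%:E)%E]).
    by apply: open_nbhs_nbhs; split; [exact: open_ereal_lt_ereal|rewrite /= lte_fin].
  have sN N : (N0 <= N)%N ->
      (4^-1%:E * (\int[leb]_(x in D) (m M x)%:E - e%:E) <= partial_L4 u N)%E.
    move=> /N0P/ltW le; rewrite lee_pdivrMl// leeBlDr//.
    apply: (le_trans (bound N)); apply: leeD => //.
    apply: (@le_trans _ _ ((4 * M%:R)%:E * (e / (4 * M%:R + 1))%:E)%E).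
      by apply: lee_wpmul2l => //; rewrite lee_fin mulr_ge0.
    rewrite -EFinM lee_fin mulrCA; apply: ler_piMr; first exact: ltW.
    by rewrite ler_pdivrMr ?mul1r ?lerDl// ltr_wpDl// mulr_ge0.
  have := le_limn_einf sN.
  by rewrite lee_pdivrMl// leeBlDr.
have -> : (\int[leb]_(x in period) (normc (f x) ^+ 4)%:E =
    limn (fun M => \int[leb]_(x in D) (m M x)%:E))%E.
  rewrite -monotone_convergence; last first.
  - move=> x _ M1 M2 M12; rewrite lee_fin ler_pXn2r ?nnegrE ?le_min ?sqr_ge0 ?ler0n//.
    by rewrite ge_min lexx/= ge_min ler_nat M12 orbT.
  - by move=> M x _; exact: m0.
  - by move=> M; apply/measurable_EFinP; exact: mm.
  - exact: mD.
  apply: eq_integral => x _; apply/esym/cvg_lim => //.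
  apply: cvg_near_cst; exists (Num.truncn (normc (f x) ^+ 2)).+1 => // M /= xM.
  rewrite /m min_l; first by rewrite -exprM.
  by rewrite (le_trans (ltW (Num.Theory.truncnS_gt _)))// ler_nat.
apply: lime_le; last exact: nearW.
apply: ereal_nondecreasing_is_cvgn => M1 M2 M12; apply: ge0_le_integral_sup => x _.
  exact: m0.
rewrite lee_fin ler_pXn2r ?nnegrE ?le_min ?sqr_ge0 ?ler0n//.
by rewrite ge_min lexx/= ge_min ler_nat M12 orbT.
Qed.

Lemma potential_le u : (potential u <= (pi^-1)%:E * limn_einf (partial_L4 u))%E.
Proof.
have W0 : (0 <= limn_einf (partial_L4 u))%E.
  apply: (@le_limn_einf _ _ _ 0%N) => N _; apply: integral_ge0 => x _.
  by rewrite lee_fin exprn_even_ge0.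
have pi0 : 0 < pi :> R by exact: pi_gt0.
(* When no $L^2$ sum exists, [realization u] is the default zero function and the potential
   vanishes. *)
rewrite /potential /realization; case: xgetP => [f _ fu|_]; last first.
  rewrite integral0_eq; last by move=> x _; rewrite ComplexField.Normc.normc0 expr0n.
  by rewrite mule0 mule_ge0// lee_fin invr_ge0 ltW.
have e4 (p : R) : 0 < p -> p^-1 = (2^-1 * (2 * p)^-1) * 4.
  by move=> p0; field; rewrite gt_eqF.
rewrite (e4 _ pi0).
rewrite [in leRHS]EFinM -muleA; apply: lee_wpmul2l; last exact: L4_le_limn_einf.
by rewrite lee_fin mulr_ge0// invr_ge0 mulr_ge0// ltW.
Qed.

Lemma potential_ge0 u : (0 <= potential u)%E.
Proof.
have pi0 : 0 < pi :> R by exact: pi_gt0.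
apply: mule_ge0; first by rewrite lee_fin mulr_ge0// invr_ge0 mulr_ge0// ltW.
by apply: integral_ge0 => x _; rewrite lee_fin exprn_even_ge0.
Qed.

End potential_bound.

Section measure_of_mass_one.
Context d (T : measurableType d) (R : realType).
Context (m : {measure set T -> \bar R}) (m1 : m setT = 1%E).

(** An alias that carries the probability structure, so that Tonelli's theorem can be applied to
    [mu]. *)
Definition mass_one_measure of m setT = 1%E : set T -> \bar R := m.

HB.instance Definition _ := Measure.on (mass_one_measure m1).
HB.instance Definition _ :=
  Measure_isProbability.Build _ _ _ (mass_one_measure m1) m1.

End measure_of_mass_one.

(** * Expected fourth powers of the $L^4$ norms of partial sums *)

Section L4_expectation.
Context {R : realType}.
Notation leb := (@lebesgue_measure R).
Local Notation TX := (torus_dist R * measurableTypeR R)%type.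

(** The indicator extends the integrand by zero outside a period, giving a function on the whole
    product space for Tonelli's theorem. *)
Definition local_L4 N (z : TX) : R :=
  normc (partial_sum z.1 N z.2) ^+ 4 * \1_(@period R) z.2.

Lemma local_L4_ge0 N z : 0 <= local_L4 N z.
Proof. by rewrite mulr_ge0// exprn_even_ge0. Qed.

Lemma measurable_local_L4 N : measurable_fun setT (local_L4 N).
Proof.
apply: measurable_funM; last first.
  apply: (measurableT_comp _ measurable_snd); apply: measurable_indic.
  exact: measurable_period.
apply: measurable_normc_pow4; apply: cmeas_sum => k; apply: cmeasM.
  have [c1 c2] := @cmeas_coef R (k%:Z - N%:Z).
  split; first exact: (measurableT_comp c1 measurable_fst).
  exact: (measurableT_comp c2 measurable_fst).
have [c1 c2] := @cmeas_cis R (k%:Z - N%:Z)%:~R.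
split; first exact: (measurableT_comp c1 measurable_snd).
exact: (measurableT_comp c2 measurable_snd).
Qed.

Lemma partial_L4E N (u : torus_dist R) :
  partial_L4 u N = (\int[leb]_x (local_L4 N (u, x))%:E)%E.
Proof.
rewrite /partial_L4 integral_mkcond; apply: eq_integral => x _.
by rewrite patchE /local_L4 indicE /=; case: ifP => _; rewrite ?mulr1 ?mulr0.
Qed.

Lemma measurable_partial_L4 N : measurable_fun setT (fun u : torus_dist R => partial_L4 u N).
Proof.
rewrite (_ : (fun _ => _) =
    fun u : torus_dist R => (\int[leb]_x (local_L4 N (u, x))%:E)%E);
  last by apply/funext => u; exact: partial_L4E.
apply: (@measurable_fun_fubini_tonelli_F _ _ (torus_dist R) (measurableTypeR R) R leb
  (fun z => (local_L4 N z)%:E)).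
  by apply/measurable_EFinP; exact: measurable_local_L4.
by move=> z; rewrite lee_fin local_L4_ge0.
Qed.

Lemma integral_partial_L4_le (mu : probability (torus_dist R) R) (N : nat) (K : R) :
  0 <= K ->
  (forall x, (\int[mu]_u (normc (partial_sum u N x) ^+ 4)%:E <= K%:E)%E) ->
  (\int[mu]_u partial_L4 u N <= (K * (2 * pi))%:E)%E.
Proof.
move=> K0 muK; under eq_integral do rewrite partial_L4E.
have mE : measurable_fun setT (fun z : TX => (local_L4 N z)%:E).
  by apply/measurable_EFinP; exact: measurable_local_L4.
have E0 (z : TX) : (0 <= (local_L4 N z)%:E)%E by rewrite lee_fin local_L4_ge0.
have := @fubini_tonelli _ _ (torus_dist R) (measurableTypeR R) R mu leb _ mE E0.
move=> ->.
apply: (@le_trans _ _ (\int[leb]_(x in @period R) K%:E)%E).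
  rewrite [leRHS]integral_mkcond; apply: ge0_le_integral_sup => x _.
    by apply: integral_ge0 => u _.
  rewrite patchE /fubini_G; case: ifPn => xp.
    under eq_integral do rewrite /local_L4 /= indicE xp mulr1.
    exact: muK.
  under eq_integral do rewrite /local_L4 /= indicE (negbTE xp) mulr0.
  by rewrite integral0.
rewrite integral_cst; last exact: measurable_period.
rewrite EFinM; apply: lee_wpmul2l; first by rewrite lee_fin.
have per : leb (@period R) = (2 * pi)%:E.
  rewrite /period lebesgue_measure_itv/= lte_fin mulr_gt0 ?pi_gt0//.
  by rewrite -EFinB subr0.
by rewrite -per; exact: lexx.
Qed.

End L4_expectation.

(** * Null sets of the Gibbs measure and of the Gaussian law *)

Section gibbs_density.
Context {R : realType} (alpha : R).
Context (d : measure_display) (Omega : measurableType d) (P : probability Omega R).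
Context (g : int -> Omega -> R[i]%C) (mu rho : {measure set (torus_dist R) -> \bar R}).
Hypothesis halpha : 6 / 5 < alpha.
Hypothesis hgauss : forall n, standard_complex_gaussian P (g n).
Hypothesis hindep : mutually_independent P g.
Hypothesis hmu : is_law_of P (random_series alpha g) mu.
Hypothesis hrho : is_gibbs mu rho.

(** A measurable function that dominates [potential] up to the factor $1/\pi$. *)
Let W (u : torus_dist R) : \bar R := limn_einf (partial_L4 u).

Let W0 u : (0 <= W u)%E.
Proof.
apply: (@le_limn_einf _ _ _ 0%N) => N _; apply: integral_ge0 => x _.
by rewrite lee_fin exprn_even_ge0.
Qed.

Let mW : measurable_fun setT W.
Proof.
rewrite (_ : W = fun u => (- limn_esup (fun N => - partial_L4 u N))%E)//.
apply: (measurableT_comp (@oppe_measurable R setT)).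
apply: measurable_fun_limn_esup => N.
by apply: (measurableT_comp (@oppe_measurable R setT)); exact: measurable_partial_L4.
Qed.

Lemma integral_limn_einf_L4_lty : (\int[mu]_u W u < +oo)%E.
Proof.
have muT := law_setT hmu.
have [m4 m40 m4P] := law_fourth_moment hgauss hmu.
pose mu1 : probability (torus_dist R) R := mass_one_measure muT.
(* Here $22=1+21$, where 21 bounds the sum of the variances uniformly in [N]. *)
pose K := 9 * m4 * 22 ^+ 2.
have K0 : 0 <= K by rewrite mulr_ge0// mulr_ge0// ltW.
have muK N x : (\int[mu1]_u (normc (partial_sum u N x) ^+ 4)%:E <= K%:E)%E.
  pose J := map (fun k : 'I_(2 * N).+1 => k%:Z - N%:Z) (index_enum _).
  have uJ : uniq J.
    rewrite map_inj_uniq; first exact: index_enum_uniq.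
    by move=> i j /addIr[] /val_inj.
  have := @fourth_moment_sum R mu (mode_weight alpha) m4
    (law_coef_flip hgauss hindep hmu) (mode_weight_gt0 alpha) m40 m4P J
    (fun n => cis (n%:~R * x)) (fun n => normc_cis _) uJ.
  under eq_integral do rewrite /J big_map.
  move=> /le_trans; apply; rewrite lee_fin /K ler_pM2l ?mulr_gt0//.
  have S0 : 0 <= \sum_(n <- J) mode_weight alpha n.
    by apply: sumr_ge0 => n _; exact/ltW/mode_weight_gt0.
  rewrite ler_pXn2r ?nnegrE ?addr_ge0//.
  by have := mode_weight_sum_le N halpha; rewrite /J big_map; lra.
apply: (@le_lt_trans _ _ (limn_einf (fun N => \int[mu]_u partial_L4 u N))%E).
  apply: fatou => //; first exact: measurable_partial_L4.
  by move=> N u _; apply: integral_ge0 => x _; rewrite lee_fin exprn_even_ge0.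
apply: (@le_lt_trans _ _ (K * (2 * pi))%:E); last exact: ltry.
rewrite limn_einf_lim; apply: lime_le.
  by apply: ereal_nondecreasing_is_cvgn; exact: nondecreasing_einfs.
apply: nearW => N; apply: (@le_trans _ _ (\int[mu]_u partial_L4 u N)%E).
  by apply: ereal_inf_lbound; exists N => /=.
exact: (integral_partial_L4_le K0 (muK N)).
Qed.

(** The Gibbs density is at least $e^{-W/\pi}$ where [W] is finite. This measurable minorant, set to
    0 elsewhere, vanishes only where [W] is infinite, a [mu]-null set because [W] is integrable. *)
Lemma gibbs_null_law_null (A : set (torus_dist R)) : measurable A ->
  rho A = 0%E -> mu A = 0%E.
Proof.
move=> mA rhoA.
pose F : set (torus_dist R) := [set u | W u \is a fin_num].
have mF : measurable F.
  rewrite -[X in measurable X]setTI; exact: emeasurable_fin_num.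
pose h u := (expR (- (pi^-1 * fine (W u))) * \1_F u)%:E.
have mh : measurable_fun setT h.
  apply/measurable_EFinP; apply: measurable_funM; last exact: measurable_indic.
  apply: (measurableT_comp (@measurable_expR R)).
  apply: (measurableT_comp (@oppr_measurable R setT)).
  apply: measurable_funM => //.
  exact: (measurableT_comp (@fine_measurable R setT measurableT) mW).
have h0 u : (0 <= h u)%E by rewrite lee_fin mulr_ge0// expR_ge0.
apply: (null_of_integral_eq0 mA mh h0).
  apply/eqP; rewrite eq_le; apply/andP; split; last by apply: integral_ge0.
  rewrite -rhoA hrho//; apply: ge0_le_integral_sup => u _ //.
  rewrite /h indicE; case: (boolP (u \in F)) => [/[!inE] uF|_]; last first.
    by rewrite mulr0 expeR_ge0.
  rewrite mulr1 -[leLHS]/(expeR (- (pi^-1 * fine (W u)))%:E) lee_expeR.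
  rewrite EFinN leeN2 EFinM fineK//; exact: potential_le.
have Wint : mu.-integrable setT W.
  apply/integrableP; split => //.
  by under eq_integral do rewrite gee0_abs//; exact: integral_limn_einf_L4_lty.
have [N [mN N0 subN]] := integrable_ae measurableT Wint.
have mh0 : measurable [set u | h u = 0%E].
  rewrite -[X in measurable X]setTI; apply: (mh measurableT [set 0%E]).
  exact: emeasurable_set1.
apply/eqP; rewrite eq_le measure_ge0 andbT.
apply: (@le_trans _ _ (mu N)); last by rewrite N0.
apply: le_measure; rewrite ?inE//.
move=> u /= hu; apply: subN => /= /(_ I) uF; move: hu.
rewrite /h indicE mem_set// mulr1 => -[/eqP]; rewrite gt_eqF//; exact: expR_gt0.
Qed.

Lemma gibbs_setT_lty : (rho setT < +oo)%E.
Proof.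
rewrite hrho//; apply: (@le_lt_trans _ _ (\int[mu]_(u in [set: torus_dist R]) 1)%E).
  apply: ge0_le_integral_sup => u _; first exact: expeR_ge0.
  by rewrite -expeR0 lee_expeR oppe_le0 potential_ge0.
by rewrite integral_cst// mul1e (law_setT hmu) ltry.
Qed.

End gibbs_density.

(** * Almost sure recurrence of the solutions *)

Theorem corollary1p2 (R : realType) (alpha sigma : R)
    (d : measure_display) (Omega : measurableType d) (P : probability Omega R)
    (g : int -> Omega -> R[i]%C)
    (mu rho : {measure set (torus_dist R) -> \bar R})
    (Sigma : set (torus_dist R)) (Phi : R -> torus_dist R -> torus_dist R)
    (halpha : 6 / 5 < alpha)
    (hsigma : sigma < (alpha - 1) / 2)
    (hgauss : forall n, standard_complex_gaussian P (g n))
    (hindep : mutually_independent P g)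
    (hmu : is_law_of P (random_series alpha g) mu)
    (hrho : is_gibbs mu rho)
    (hflow : gibbs_flow alpha sigma rho Sigma Phi) :
  {ae mu, forall u0, Sigma u0 -> forall t : R,
    exists n_ : nat -> nat,
      [/\ (0 < n_ 0)%N, {homo n_ : j k / (j < k)%N} &
        sobolev_norm sigma (fun m : int => Phi ((n_ k)%:R * t) u0 m - u0 m)
          @[k --> \oo] --> 0%E]}.
Proof.
have [N [mN N0 subN]] :=
  almost_flow_recurrence hflow (gibbs_setT_lty hmu hrho).
exists N; split => //.
  exact: (gibbs_null_law_null halpha hgauss hindep hmu hrho mN N0).
move=> u0 nu0; apply: subN; split.
  by apply: contrapT => nS; apply: nu0 => /nS.
by move=> H; apply: nu0 => _.
Qed.
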